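(* Consider the sparse signal in noise model: $S\in\{1,\dots,N\}$, $\mathcal{X}_S=\{\mathbf{x}\in\mathbb{R}^N:\|\mathbf{x}\|_0\le S\}$, $\sigma>0$, observation $\mathbf{y}=\mathbf{x}+\mathbf{n}\in\mathbb{R}^N$ with $\mathbf{n}\sim\mathcal{N}(\mathbf{0},\sigma^2\mathbf{I})$, $\mathbf{x}\in\mathcal{X}_S$, parameter function $g:\mathcal{X}_S\to\mathbb{R}$, and $\mathbf{x}_0\in\mathcal{X}_S$. Define $\nu_{\mathbf{x}_0}(\mathbf{x})=\exp\big(-\tfrac{1}{2\sigma^2}\|\mathbf{x}_0\|_2^2+\tfrac{1}{\sigma^2}\mathbf{x}^T\mathbf{x}_0\big)$ and $\psi_{\mathbf{x}_0}(\mathbf{x},\mathbf{y})=\exp\big(\tfrac{\mathbf{y}^T(\sigma\mathbf{x}-\mathbf{x}_0)}{\sigma^2}+\tfrac{\mathbf{x}_0^T\mathbf{x}}{\sigma}-\tfrac{\|\mathbf{x}\|_2^2}{2}\big)$. (1) A bias function $c:\mathcal{X}_S\to\mathbb{R}$ is valid at $\mathbf{x}_0$ if and only if $\gamma=c+g$ can be written as $\gamma(\mathbf{x})=\frac{1}{\nu_{\mathbf{x}_0}(\mathbf{x})}\sum_{\mathbf{p}\in\mathbb{Z}_+^N\cap\mathcal{X}_S}\frac{a[\mathbf{p}]}{\sqrt{\mathbf{p}!}}\big(\tfrac{\mathbf{x}}{\sigma}\big)^{\mathbf{p}}$ for all $\mathbf{x}\in\mathcal{X}_S$, with some $a\in\ell^2(\mathbb{Z}_+^N\cap\mathcal{X}_S)$;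 this sequence is unique for given $c$. (2) If $c$ is valid at $\mathbf{x}_0$, let $a_{\mathbf{x}_0}[\mathbf{p}]=\frac{1}{\sqrt{\mathbf{p}!}}\frac{\partial^{\mathbf{p}}(\gamma(\sigma\mathbf{x})\nu_{\mathbf{x}_0}(\sigma\mathbf{x}))}{\partial\mathbf{x}^{\mathbf{p}}}\big|_{\mathbf{x}=\mathbf{0}}$ for $\mathbf{p}\in\mathbb{Z}_+^N\cap\mathcal{X}_S$. Then (a) the minimum achievable variance at $\mathbf{x}_0$ is $M(c,\mathbf{x}_0)=\sum_{\mathbf{p}\in\mathbb{Z}_+^N\cap\mathcal{X}_S}a_{\mathbf{x}_0}^2[\mathbf{p}]-\gamma^2(\mathbf{x}_0)$; and (b) the LMV estimator at $\mathbf{x}_0$ is $$\hat g^{(c,\mathbf{x}_0)}(\mathbf{y})=\sum_{\mathbf{p}\in\mathbb{Z}_+^N\cap\mathcal{X}_S}\frac{a_{\mathbf{x}_0}[\mathbf{p}]}{\sqrt{\mathbf{p}!}}\frac{\partial^{\mathbf{p}}\psi_{\mathbf{x}_0}(\mathbf{x},\mathbf{y})}{\partial\mathbf{x}^{\mathbf{p}}}\Big|_{\mathbf{x}=\mathbf{0}}.$$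
   Context: $\mathbb{Z}_+^N\cap\mathcal{X}_S$ is the set of multi-indices $\mathbf{p}\in\mathbb{Z}_+^N$ with at most $S$ nonzero entries; $\mathbf{p}!=\prod p_l!$, $\mathbf{z}^{\mathbf{p}}=\prod z_l^{p_l}$, $\partial^{\mathbf{p}}/\partial\mathbf{x}^{\mathbf{p}}=\prod\partial^{p_l}/\partial x_l^{p_l}$. An estimator $\hat g:\mathbb{R}^N\to\mathbb{R}$ has bias $\mathsf{E}_{\mathbf{x}}\{\hat g(\mathbf{y})\}-g(\mathbf{x})$ and variance $v(\hat g;\mathbf{x})$. $c$ is valid at $\mathbf{x}_0$ if some estimator has finite variance at $\mathbf{x}_0$ and bias equal to $c$ on all of $\mathcal{X}_S$; $M(c,\mathbf{x}_0)$ is the infimum of $v(\hat g;\mathbf{x}_0)$ over such estimators; an LMV estimator is one attaining it. *)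

(* Defs.v *)
From HB Require Import structures.
From mathcomp Require Import all_boot all_order all_algebra.
From mathcomp Require Import all_classical all_reals all_analysis.
Import Order.TTheory GRing.Theory Num.Theory.
Import numFieldNormedType.Exports.


Local Open Scope classical_set_scope.
Local Open Scope ring_scope.

Definition XS {R : realType} (N S : nat) : set 'rV[R]_N :=
  [set x : 'rV[R]_N | (#|[set l : 'I_N | x ord0 l != 0%R]| <= S)%N].

Definition dotv {R : realType} {N : nat} (x y : 'rV[R]_N) : R :=
  \sum_(l < N) x ord0 l * y ord0 l.

Definition nu {R : realType} {N : nat} (s : R) (x0 x : 'rV[R]_N) : R :=
  expR (- dotv x0 x0 / (2 * s ^+ 2) + dotv x x0 / s ^+ 2).

Definition psi {R : realType} {N : nat} (s : R) (x0 x y : 'rV[R]_N) : R :=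
  expR (dotv y (s *: x - x0) / s ^+ 2 + dotv x0 x / s - dotv x x / 2).

Definition MI (N S : nat) : set {ffun 'I_N -> nat} :=
  [set p | (#|[set l : 'I_N | p l != 0%N]| <= S)%N].

Definition mfact {N : nat} (p : {ffun 'I_N -> nat}) : nat := (\prod_(l < N) (p l)`!)%N.

Definition mpow {R : realType} {N : nat} (z : 'rV[R]_N) (p : {ffun 'I_N -> nat}) : R :=
  \prod_(l < N) z ord0 l ^+ p l.

Definition pder {R : realType} {N : nat} (l : 'I_N) (f : 'rV[R]_N -> R) : 'rV[R]_N -> R :=
  'D_(delta_mx ord0 l) f.

Definition mder {R : realType} {N : nat} (p : {ffun 'I_N -> nat}) (f : 'rV[R]_N -> R)
  : 'rV[R]_N -> R :=
  foldr (fun l h => iter (p l) (pder l) h) f (enum 'I_N).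

(* sum over a countable index set of a real family, as an (unordered)
   extended-real sum: positive part minus negative part *)
Definition ssum {R : realType} {T : choiceType} (D : set T) (F : T -> R) : \bar R :=
  (\esum_(i in D) (Num.max (F i) 0)%:E - \esum_(i in D) (Num.max (- F i) 0)%:E)%E.

Definition l2 {R : realType} {T : choiceType} (D : set T) (a : T -> R) : Prop :=
  (\esum_(i in D) ((a i) ^+ 2)%:E < +oo)%E.

(* iterated integral against the product of the 1-d normal laws
   N(m_1,s^2) x ... x N(m_n,s^2), for nonnegative integrands *)
Fixpoint gint {R : realType} (s : R) {n : nat} :
    n.-tuple R -> (n.-tuple R -> \bar R) -> \bar R :=
  match n return n.-tuple R -> (n.-tuple R -> \bar R) -> \bar R with
  | 0%N => fun _ f => f [tuple]
  | k.+1 => fun m f =>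
      (\int[normal_prob (thead m) s]_t
         gint s (n:=k) (behead_tuple m) (fun y => f (cons_tuple t y)))%E
  end.

Definition tup {R : realType} {N : nat} (x : 'rV[R]_N) : N.-tuple R :=
  [tuple x ord0 i | i < N].

Definition rowt {R : realType} {N : nat} (y : N.-tuple R) : 'rV[R]_N :=
  \row_(i < N) tnth y i.

Definition Ex {R : realType} {N : nat} (s : R) (x : 'rV[R]_N) (h : 'rV[R]_N -> R) : \bar R :=
  (gint s (tup x) (fun y => (Num.max (h (rowt y)) 0)%:E)
   - gint s (tup x) (fun y => (Num.max (- h (rowt y)) 0)%:E))%E.

Definition estimator {R : realType} {N : nat} (h : 'rV[R]_N -> R) : Prop :=
  measurable_fun [set: N.-tuple R] (fun y => h (rowt y)).

Definition var {R : realType} {N : nat} (s : R) (x : 'rV[R]_N) (h : 'rV[R]_N -> R) : \bar R :=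
  Ex s x (fun y => (h y - fine (Ex s x h)) ^+ 2).

Definition admissible {R : realType} {N : nat} (S : nat) (s : R) (g c : 'rV[R]_N -> R)
    (x0 : 'rV[R]_N) (h : 'rV[R]_N -> R) : Prop :=
  [/\ estimator h, (var s x0 h < +oo)%E &
      forall x, XS N S x -> (Ex s x h = (c x + g x)%:E)%E].

Definition valid {R : realType} {N : nat} (S : nat) (s : R) (g c : 'rV[R]_N -> R)
    (x0 : 'rV[R]_N) : Prop :=
  exists h, admissible S s g c x0 h.

Definition Mmin {R : realType} {N : nat} (S : nat) (s : R) (g c : 'rV[R]_N -> R)
    (x0 : 'rV[R]_N) : \bar R :=
  ereal_inf [set var s x0 h | h in admissible S s g c x0].

Definition LMV {R : realType} {N : nat} (S : nat) (s : R) (g c : 'rV[R]_N -> R)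
    (x0 : 'rV[R]_N) (h : 'rV[R]_N -> R) : Prop :=
  admissible S s g c x0 h /\ var s x0 h = Mmin S s g c x0.

Definition acoef {R : realType} {N : nat} (s : R) (gam : 'rV[R]_N -> R)
    (x0 : 'rV[R]_N) (p : {ffun 'I_N -> nat}) : R :=
  (Num.sqrt (mfact p)%:R)^-1 *
  mder p (fun x => gam (s *: x) * nu s x0 (s *: x)) 0.

Definition lmv_term {R : realType} {N : nat} (s : R) (gam : 'rV[R]_N -> R)
    (x0 : 'rV[R]_N) (p : {ffun 'I_N -> nat}) (y : 'rV[R]_N) : R :=
  acoef s gam x0 p / Num.sqrt (mfact p)%:R * mder p (fun x => psi s x0 x y) 0.

(* Main.v *)
(* The density of N(x, s^2 I) with respect to N(x0, s^2 I), multiplied by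
   nu x0 x, is psi x0 (x / s), so an estimator h with finite variance at x0 has
   mean gamma on X_S iff gamma(x) nu(x) = E_x0 [h psi(x / s)] there.  A product
   psi(x) psi(z) is, up to the factor exp(x.z), again a Gaussian density, whence
   E_x0 [psi(x) psi(z)] = exp(x.z).  Differentiating under the expectation at 0,
   first in z and then in x, gives E_x0 [psi(x) d^p psi(0)] = x^p and shows that
   the e_p = d^p psi(0) / sqrt(p!) are orthonormal in L^2(P_x0).  For x in X_S
   the monomials x^p with p of support larger than S vanish, so Parseval turns
   exp(x.x) = sum x^(2p) / p! into psi(x) = sum_(p in MI) x^p / sqrt(p!) e_p in
   L^2.  Representations of gamma thus correspond to prescribing the coefficients
   E_x0 [h e_p], p in MI, which are the derivatives a_x0[p]; Bessel bounds
   E_x0 [h^2] below by their square sum, and Riesz-Fischer provides an h that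
   attains the bound. *)

Require Import Defs.
From HB Require Import structures.
From mathcomp Require Import all_boot all_order all_algebra.
From mathcomp Require Import all_classical all_reals all_analysis.
From mathcomp Require Import measurable_realfun ring lra.
Import Order.TTheory GRing.Theory Num.Theory.
Import numFieldNormedType.Exports.
Local Open Scope classical_set_scope.
Local Open Scope ring_scope.
Set Implicit Arguments.
Unset Strict Implicit.
Unset Printing Implicit Defensive.

(** * Sums along the finite subsets of an index set *)

Section finite_subsets.
Context {I : choiceType}.
Implicit Types (D F : set I).

Definition finite_subsets D : set_system (set I) :=
  filter_from (fsets D) (fun F0 => [set F | fsets D F /\ F0 `<=` F]).

Global Instance finite_subsets_filter D : ProperFilter (finite_subsets D).
Proof.
apply: filter_from_proper; last by move=> F finF; exists F; split.
apply: filter_from_filter; first by exists set0; exact: fsets_set0.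
move=> F G [finF FD] [finG GD]; exists (F `|` G).
  by split; [rewrite finite_setU|rewrite subUset].
by move=> H [HD]; rewrite subUset => -[FH GH].
Qed.

Lemma near_fsets D : \forall F \near finite_subsets D, fsets D F.
Proof. by exists set0; [exact: fsets_set0|move=> F []]. Qed.

Lemma near_finite_subsets_sub D F : fsets D F ->
  \forall G \near finite_subsets D, F `<=` G.
Proof. by move=> FD; exists F => // G []. Qed.

Lemma near_finite_subsets_in D i : D i -> \forall F \near finite_subsets D, F i.
Proof.
move=> Di; have : fsets D [set i] by split=> [|_ ->//]; exact: finite_set1.
by move=> /near_finite_subsets_sub; apply: filterS => F; exact.
Qed.

End finite_subsets.

Section unordered_sums.
Context {R : realType} {I : choiceType}.
Implicit Types (D : set I) (u v : I -> R).

Lemma summable_ge0 D u : (forall i, 0 <= u i) ->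
  summable D (EFin \o u) = (\esum_(i in D) (u i)%:E < +oo)%E.
Proof.
move=> u0; rewrite /summable; congr (_ < _)%E.
by apply: eq_esum => i _ /=; rewrite ger0_norm.
Qed.

Lemma esum_fin_num D u : (forall i, 0 <= u i) -> summable D (EFin \o u) ->
  \esum_(i in D) (u i)%:E \is a fin_num.
Proof.
move=> u0; rewrite summable_ge0// ge0_fin_numE// esum_ge0// => i _.
by rewrite lee_fin.
Qed.

Lemma ler_fsum_esum D F u : (forall i, 0 <= u i) -> summable D (EFin \o u) ->
  fsets D F -> \sum_(i \in F) u i <= fine (\esum_(i in D) (u i)%:E).
Proof.
move=> u0 sumu [finF FD].
by rewrite -lee_fin fineK ?esum_fin_num// -fsumEFin//; apply: esum_ge; exists F.
Qed.

Lemma cvg_esum D u : (forall i, 0 <= u i) -> summable D (EFin \o u) ->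
  \sum_(i \in F) u i @[F --> finite_subsets D] -->
    fine (\esum_(i in D) (u i)%:E).
Proof.
move=> u0 sumu; have fin := esum_fin_num u0 sumu; apply/cvgrPdist_lt => e e0.
have [_ [F0 F0D <-]] := ub_ereal_sup_adherent e0 fin.
rewrite -[ereal_sup _]/(\esum_(i in D) (u i)%:E) -(fineK fin) -EFinB.
have [finF0 _] := F0D; rewrite fsumEFin// lte_fin => ltF0.
have := near_finite_subsets_sub F0D; have := near_fsets D.
apply: filterS2 => F FD F0F; have [finF _] := FD.
rewrite ger0_norm ?subr_ge0 ?ler_fsum_esum// ltrBlDr -ltrBlDl.
apply: lt_le_trans ltF0 _; rewrite -lee_fin -!fsumEFin//.
apply: lee_fsum_nneg_subset => //; first by move=> i /set_mem/F0F/mem_set.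
by move=> i _; rewrite lee_fin.
Qed.

Lemma l2_summableM D u v : l2 D u -> l2 D v ->
  summable D (fun i => (u i * v i)%:E).
Proof.
rewrite /l2 -!summable_ge0 => [su sv||]; [|by move=> i; exact: sqr_ge0..].
apply: le_lt_trans (summableD su sv); apply: le_esum => i _ /=.
rewrite lee_fin normrM [leRHS]ger0_norm ?addr_ge0 ?sqr_ge0//.
rewrite -(real_normK (num_real (u i))) -(real_normK (num_real (v i))).
by have := normr_ge0 (u i); have := normr_ge0 (v i); nra.
Qed.

Lemma max0_ge0 (x : R) : 0 <= Num.max x 0.
Proof. by rewrite le_max lexx orbT. Qed.

Lemma summable_max0 D u : summable D (EFin \o u) ->
  summable D (fun i => (Num.max (u i) 0)%:E).
Proof.
apply: le_lt_trans; apply: le_esum => i _.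
by rewrite lee_fin ger0_norm ?max0_ge0// ge_max ler_norm normr_ge0.
Qed.

Lemma summable_oppr D u : summable D (EFin \o u) -> summable D (EFin \o (\- u)).
Proof. by rewrite -[_ \o (\- _)]/(\- (EFin \o u))%E -summableN. Qed.

Lemma ssum_fin_num D u : summable D (EFin \o u) -> ssum D u \is a fin_num.
Proof.
move=> sumu; rewrite fin_numB; apply/andP; split; apply: esum_fin_num => [i|].
- exact: max0_ge0.
- exact: summable_max0.
- exact: max0_ge0.
- exact: (summable_max0 (summable_oppr sumu)).
Qed.

Lemma cvg_ssum D u : summable D (EFin \o u) ->
  \sum_(i \in F) u i @[F --> finite_subsets D] --> fine (ssum D u).
Proof.
move=> sumu; have := ssum_fin_num sumu; rewrite fin_numB => /andP[finp finn].
rewrite /ssum fineB//.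
have cvgp := cvg_esum (fun i => max0_ge0 (u i)) (summable_max0 sumu).
have cvgn := cvg_esum (fun i => max0_ge0 (- u i))
  (summable_max0 (summable_oppr sumu)).
apply: cvg_trans (cvgB cvgp cvgn).
apply: near_eq_cvg; apply: filterS (near_fsets D) => F [finF _] /=.
rewrite !fctE !fsbig_finite//= -sumrB; apply: eq_bigr => i _.
by case: (lerP 0 (u i)) => ui; [rewrite max_r ?oppr_le0// subr0|
  rewrite max_l ?oppr_ge0 ?ltW// sub0r opprK].
Qed.

Lemma ssum_cvg D u (r : R) : summable D (EFin \o u) ->
  \sum_(i \in F) u i @[F --> finite_subsets D] --> r -> ssum D u = r%:E.
Proof.
move=> sumu ur; rewrite -(fineK (ssum_fin_num sumu)); congr EFin.
exact: cvg_unique (cvg_ssum sumu) ur.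
Qed.

End unordered_sums.

(** * Orthonormal families in a complete semi-inner product space *)

Section semi_inner_product.
Context {R : realType} {V : lmodType R}.
Variable dot : {symmetric V}.
Hypothesis dot_ge0 : forall u, 0 <= dot u u.
Local Notation "''[' u , v ]" := (dot u v).
Local Notation "''[' u ]" := '[u, u].
Implicit Types u v w : V.

Lemma dotC u v : '[u, v] = '[v, u].
Proof. by rewrite hermC expr0 mul1r. Qed.

Lemma dotZr k u v : '[u, k *: v] = k * '[u, v].
Proof. exact: linearZr_LR. Qed.

Lemma dnormB u v : '[u - v] = '[u] - 2 * '[u, v] + '[v].
Proof. by rewrite hnormB expr0 mul1r/=; ring. Qed.

Lemma dnormBC u v : '[u - v] = '[v - u].
Proof. by rewrite -hnormN opprB. Qed.

Lemma dnormB_le u v w : '[u - w] <= 2 * ('[u - v] + '[v - w]).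
Proof.
have := dot_ge0 ((u - v) - (v - w)); rewrite dnormB => ge0.
rewrite (_ : u - w = (u - v) - (w - v)); last by rewrite opprB addrA subrK.
by rewrite dnormB -(opprB v w) linearNr hnormN; lra.
Qed.

Lemma dot_CauchySchwarz u v : '[u, v] ^+ 2 <= '[u] * '[v].
Proof.
have quad t : 0 <= '[u] - 2 * t * '[u, v] + t ^+ 2 * '[v].
  by have := dot_ge0 (u - t *: v); rewrite dnormB !dotZr linearZl_LR/=; lra.
have [v0|v0] := eqVneq '[v] 0.
  have [->|uv0] := eqVneq '[u, v] 0; first by rewrite v0 expr2 !mulr0.
  have := quad (('[u] + 1) / '[u, v]); rewrite v0 mulr0 addr0 -!mulrA mulVf//.
  by have := dot_ge0 u; lra.
have {}v0 : 0 < '[v] by rewrite lt_def v0 dot_ge0.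
rewrite -subr_ge0 (_ : _ - _ = '[v] * ('[u] - 2 * ('[u, v] / '[v]) * '[u, v] +
  ('[u, v] / '[v]) ^+ 2 * '[v])); first by rewrite mulr_ge0// ltW.
by field; rewrite gt_eqF.
Qed.

Section limits.
Context {T : Type} {F : set_system T} {FF : Filter F}.
Variables (u : T -> V) (v : V).
Hypothesis uv : '[v - u x] @[x --> F] --> (0 : R).

Lemma cvg_dotl w : '[u x, w] @[x --> F] --> '[v, w].
Proof.
apply/cvgrPdist_lt => e e0.
have w1 : 0 < '[w] + 1 by have := dot_ge0 w; lra.
have d0 : 0 < e ^+ 2 / ('[w] + 1) by rewrite divr_gt0// exprn_gt0.
apply: filterS (cvgr_lt _ uv _ d0) => x /=; rewrite ltr_pdivlMr// => lte.
rewrite -linearBl -ltr_sqr ?nnegrE ?(ltW e0)// real_normK ?num_real//.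
apply: le_lt_trans (dot_CauchySchwarz _ _) _; apply: le_lt_trans lte.
by rewrite ler_wpM2l// lerDl.
Qed.

Lemma cvg_dnorm : '[u x] @[x --> F] --> '[v].
Proof.
have -> : (fun x => '[u x]) = (fun x => '[v - u x] + 2 * '[u x, v] - '[v]).
  by apply/funext => x; rewrite dnormB (dotC v); ring.
rewrite [X in _ --> X](_ : _ = 0 + 2 * '[v] - '[v]); last by ring.
apply: cvgB; last exact: cvg_cst.
by apply: cvgD => //; apply: cvgM; [exact: cvg_cst|exact: cvg_dotl].
Qed.

End limits.

Definition dot_cauchy (F : set_system V) :=
  forall e : R, 0 < e -> exists w, \forall u \near F, '[w - u] < e.

Definition dot_complete := forall F : set_system V, ProperFilter F ->
  dot_cauchy F -> exists v, '[v - u] @[u --> F] --> (0 : R).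

Lemma fast_cauchy_complete (r : R) : 0 < r < 1 ->
  (forall u : nat -> V,
    (forall k l, (k <= l)%N -> '[u l - u k] <= r ^+ k) ->
    exists v, forall k, '[v - u k] <= r ^+ k) ->
  dot_complete.
Proof.
move=> /andP[r0 r1] fast F FF cauchyF.
have cvgr0 : r ^+ k @[k --> \oo] --> (0 : R).
  by apply: cvg_expr; rewrite gtr0_norm.
have rk0 k : 0 < r ^+ k by rewrite exprn_gt0.
have /choice[w wF] k : exists w, \forall u \near F, '[w - u] < r ^+ k / 4.
  by apply: cauchyF; rewrite divr_gt0.
have [k l kl|v vw] := fast w.
  have [u [uk ul]] := filter_ex (filterI (wF k) (wF l)).
  have := dnormB_le (w l) u (w k); rewrite (dnormBC u).
  have : r ^+ l <= r ^+ k by rewrite ler_wiXn2l// ltW.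
  by lra.
exists v; apply/cvgrPdist_lt => e e0.
have e4 : 0 < e / 4 by rewrite divr_gt0.
have [k] := filter_ex (cvgr_lt _ cvgr0 _ e4).
rewrite ltr_pdivlMr// => ke; apply: filterS (wF k) => u uk.
rewrite sub0r normrN ger0_norm//; have := dnormB_le v (w k) u; have := vw k.
by move: uk ke (rk0 k); lra.
Qed.

Section orthonormal.
Context {I : choiceType}.
Variable e : I -> V.
Hypothesis orthonormal_e : forall i j, '[e i, e j] = (i == j)%:R.
Implicit Types (F D : set I) (a : I -> R).

Definition lin_comb a F := \sum_(i \in F) a i *: e i.

Lemma dot_lin_combl a F v : finite_set F ->
  '[lin_comb a F, v] = \sum_(i \in F) a i * '[e i, v].
Proof.
move=> finF; rewrite /lin_comb !fsbig_finite//= linear_sumlz.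
by apply: eq_bigr => i _; rewrite linearZl_LR.
Qed.

Lemma dot_lin_comb_basis a F i : finite_set F ->
  '[lin_comb a F, e i] = if i \in F then a i else 0.
Proof.
move=> finF; rewrite dot_lin_combl//; case: ifPn => [/set_mem Fi|Fi].
  rewrite (fsbigD1 i)//= orthonormal_e eqxx mulr1 fsbig1 ?addr0//.
  by move=> j [_ /eqP ji]; rewrite orthonormal_e (negbTE ji) mulr0.
rewrite fsbig1// => j Fj; rewrite orthonormal_e.
by case: eqVneq => [ji|_]; [rewrite -ji mem_set in Fi|rewrite mulr0].
Qed.

Lemma dot_lin_comb a F v : finite_set F -> (forall i, F i -> '[v, e i] = a i) ->
  '[lin_comb a F, v] = \sum_(i \in F) a i ^+ 2.
Proof.
move=> finF va; rewrite dot_lin_combl//; apply: eq_fsbigr => i /set_mem Fi.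
by rewrite dotC va// expr2.
Qed.

Lemma dnorm_lin_comb a F : finite_set F ->
  '[lin_comb a F] = \sum_(i \in F) a i ^+ 2.
Proof.
move=> finF; apply: dot_lin_comb => // i Fi.
by rewrite dot_lin_comb_basis// mem_set.
Qed.

Lemma dnormB_lin_comb v F : finite_set F ->
  '[v - lin_comb (fun i => '[v, e i]) F] =
  '[v] - \sum_(i \in F) '[v, e i] ^+ 2.
Proof.
move=> finF; rewrite dnormB dnorm_lin_comb// dotC dot_lin_comb//; ring.
Qed.

Lemma bessel v D : (\esum_(i in D) ('[v, e i] ^+ 2)%:E <= '[v]%:E)%E.
Proof.
apply: ge_ereal_sup => _ [F [finF _] <-].
by rewrite fsumEFin// lee_fin -subr_ge0 -dnormB_lin_comb.
Qed.

Lemma l2_dot v D : l2 D (fun i => '[v, e i]).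
Proof. exact: le_lt_trans (bessel v D) (ltry _). Qed.

Lemma cvg_fourier v D : \esum_(i in D) ('[v, e i] ^+ 2)%:E = '[v]%:E ->
  '[v - lin_comb (fun i => '[v, e i]) F] @[F --> finite_subsets D] --> (0 : R).
Proof.
move=> full.
have sumv : summable D (fun i => ('[v, e i] ^+ 2)%:E).
  by rewrite summable_ge0 ?full ?ltry// => i; exact: sqr_ge0.
have := cvg_esum (fun i => sqr_ge0 '[v, e i]) sumv; rewrite full/= => cvgv.
rewrite -[0](subrr '[v]); apply: cvg_trans (cvgB (cvg_cst _) cvgv).
apply: near_eq_cvg; apply: filterS (near_fsets D) => F [finF _].
by rewrite dnormB_lin_comb.
Qed.

Lemma parseval v w D : \esum_(i in D) ('[v, e i] ^+ 2)%:E = '[v]%:E ->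
  ssum D (fun i => '[w, e i] * '[v, e i]) = '[w, v]%:E.
Proof.
move=> full; apply: ssum_cvg.
  by apply: l2_summableM; exact: l2_dot.
rewrite (dotC w v); apply: cvg_trans (cvg_dotl (cvg_fourier full) (w := w)).
apply: near_eq_cvg; apply: filterS (near_fsets D) => F [finF _].
rewrite dot_lin_combl//; apply: eq_fsbigr => i _.
by rewrite mulrC (dotC w).
Qed.

Lemma dnormB_lin_comb_sub a F G : finite_set F -> finite_set G -> F `<=` G ->
  '[lin_comb a F - lin_comb a G] =
  \sum_(i \in G) a i ^+ 2 - \sum_(i \in F) a i ^+ 2.
Proof.
move=> finF finG FG.
rewrite dnormB !dnorm_lin_comb// dot_lin_comb//; first by ring.
by move=> i /FG Gi; rewrite dot_lin_comb_basis// mem_set.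
Qed.

Lemma lin_comb_cauchy a D : l2 D a ->
  dot_cauchy (lin_comb a @ finite_subsets D).
Proof.
rewrite /l2 -summable_ge0 => [suma|i]; last exact: sqr_ge0.
move=> d d0; pose A := fine (\esum_(i in D) (a i ^+ 2)%:E).
have ltA : A - d < A by rewrite ltrBlDr ltrDl.
have cvga := cvg_esum (fun i => sqr_ge0 (a i)) suma.
have [F0 [F0D ltF0]] :=
  filter_ex (filterI (near_fsets D) (cvgr_gt _ cvga _ ltA)).
exists (lin_comb a F0).
apply: filterS2 (near_fsets D) (near_finite_subsets_sub F0D).
move=> F FD F0F /=; rewrite dnormB_lin_comb_sub//; [|by case: F0D|by case: FD].
have := ler_fsum_esum (fun i => sqr_ge0 (a i)) suma FD.
by move: ltF0; rewrite /A /=; lra.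
Qed.

Lemma riesz_fischer a D : dot_complete -> l2 D a ->
  exists2 v, forall i, D i -> '[v, e i] = a i &
    \esum_(i in D) (a i ^+ 2)%:E = '[v]%:E.
Proof.
move=> complete l2a.
have [v va] : exists v,
    '[v - lin_comb a F] @[F --> finite_subsets D] --> (0 : R).
  exact: complete (lin_comb_cauchy l2a).
exists v => [i Di|].
  apply: cvg_unique (cvg_dotl va (w := e i)) _ => //=.
  apply: cvg_near_cst.
  apply: filterS2 (near_fsets D) (near_finite_subsets_in Di).
  by move=> F [finF _] Fi; rewrite dot_lin_comb_basis// mem_set.
have a2 i := sqr_ge0 (a i).
have suma : summable D (fun i => (a i ^+ 2)%:E) by rewrite summable_ge0.
rewrite -(fineK (esum_fin_num a2 suma)); congr EFin.
apply: cvg_unique (cvg_esum a2 suma) _ => //=; apply: cvg_trans (cvg_dnorm va).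
apply: near_eq_cvg; apply: filterS (near_fsets D) => F [finF _].
by rewrite dnorm_lin_comb.
Qed.

End orthonormal.
End semi_inner_product.

(** * The space L2 and its completeness *)

Section L2_space.
Context d (T : measurableType d) (R : realType).
Variable mu : {measure set T -> \bar R}.
Local Notation L2 := (LfunType mu (lee1n 2)).

Lemma Lfun2_sqr (f : T -> R) : measurable_fun setT f ->
  (\int[mu]_x (f x ^+ 2)%:E < +oo)%E -> f \in Lfun mu 2%:E.
Proof.
move=> mf f2; apply/andP; split; rewrite inE//= /finite_norm unlock.
apply: poweR_lty; apply: le_lt_trans f2; apply: ge0_le_integral => //.
- by move=> x _; rewrite poweR_ge0.
- apply: (measurableT_comp (measurable_poweR _)) => //.
  by apply: measurableT_comp => //; exact/measurable_EFinP.
- by apply/measurable_EFinP; exact: measurable_funX.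
- by move=> x _; rewrite /= lee_fin powR_mulrn// real_normK// num_real.
Qed.

Lemma le_Lfun2 (f g : T -> R) : measurable_fun setT f ->
  (forall x, `|f x| <= g x) -> g \in Lfun mu 2%:E -> f \in Lfun mu 2%:E.
Proof.
move=> mf fg /Lfun2_integrable_sqr ig.
apply: Lfun2_sqr => //; apply: (@integrable_lty _ _ _ mu setT) => //.
apply: le_integrable ig => //.
  by apply/measurable_EFinP; exact: measurable_funX.
move=> x _; rewrite lee_fin !ger0_norm ?sqr_ge0//.
rewrite -(real_normK (num_real (f x))) ler_sqr ?nnegrE//.
exact: le_trans (normr_ge0 _) (fg x).
Qed.

Lemma integrable_L2M (f g : L2) : mu.-integrable setT (EFin \o (f \* g)).
Proof. by apply/Lfun1_integrable/Lfun2_mul_Lfun1; exact: LfunP. Qed.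

Definition L2_dot (f g : L2) : R := \int[mu]_x (f x * g x).

Lemma EFin_L2_dot (f g : L2) : (L2_dot f g)%:E = (\int[mu]_x (f x * g x)%:E)%E.
Proof. by rewrite fineK// integrable_fin_num//; exact: integrable_L2M. Qed.

Lemma L2_dot_ge0 (f : L2) : 0 <= L2_dot f f.
Proof. by apply: Rintegral_ge0 => x _; rewrite -expr2 sqr_ge0. Qed.

Lemma L2_dotC (f g : L2) : L2_dot f g = L2_dot g f.
Proof. by apply: eq_Rintegral => x _; rewrite mulrC. Qed.

Lemma L2_dot_linearl (h : L2) : linear_for *%R (L2_dot ^~ h).
Proof.
move=> k f g; have ifh := integrable_L2M f h; have igh := integrable_L2M g h.
rewrite /L2_dot -RintegralZl// -RintegralD//; last first.
  exact: (integrableZl measurableT k ifh).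
by apply: eq_Rintegral => x _; rewrite mulrDl mulrA.
Qed.

Lemma L2_dot_bilinear : bilinear_for *%R (idfun \; *%R) L2_dot.
Proof.
split=> h; first exact: L2_dot_linearl.
by move=> k f g; rewrite !(L2_dotC h); exact: L2_dot_linearl.
Qed.

Lemma L2_dot_hermitian (f g : L2) :
  L2_dot f g = (-1) ^+ false * idfun (L2_dot g f).
Proof. by rewrite expr0 mul1r L2_dotC. Qed.

HB.instance Definition _ := bilinear_isBilinear.Build R L2 L2 R _ _ L2_dot
  L2_dot_bilinear.
HB.instance Definition _ := isHermitianSesquilinear.Build R L2 false idfun
  L2_dot L2_dot_hermitian.

Lemma L2_dotZr k (f g : L2) : L2_dot f (k *: g) = k * L2_dot f g.
Proof. exact: dotZr. Qed.

Lemma L2_sumE (I : Type) (r : seq I) (f : I -> L2) x :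
  (\sum_(i <- r) f i) x = \sum_(i <- r) f i x.
Proof. by elim/big_rec2: _ => // i y g _ <-. Qed.

End L2_space.

Section ae_convergence.
Context d (T : measurableType d) (R : realType).
Variable mu : {measure set T -> \bar R}.

Lemma ae_lty_nneseries (w : (T -> \bar R)^nat) :
  (forall k, measurable_fun setT (w k)) -> (forall k x, 0 <= w k x)%E ->
  (\sum_(k <oo) \int[mu]_x w k x < +oo)%E ->
  {ae mu, forall x, (\sum_(k <oo) w k x < +oo)%E}.
Proof.
move=> mw w0; rewrite -integral_nneseries// => intw.
have W0 x : (0 <= \sum_(k <oo) w k x)%E.
  by apply: nneseries_ge0 => k _ _; exact: w0.
have intW : mu.-integrable setT (fun x => \sum_(k <oo) w k x)%E.
  apply/integrableP; split; last by under eq_integral do rewrite gee0_abs//.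
  by apply: (@ge0_emeasurable_sum _ _ _ _ w xpredT) => // k x _ _; exact: w0.
apply: filterS (integrable_ae measurableT intW) => x /(_ I).
by rewrite ge0_fin_numE.
Qed.

Lemma is_cvg_geometric_increments (u : R^nat) (c r : R) : `|r| < 1 ->
  (forall k, `|u k.+1 - u k| <= geometric c r k) -> cvgn u.
Proof.
move=> r1 ur.
have -> : u = (fun k => u 0%N + series (telescope u) k).
  by apply/funext => k; rewrite -(eq_sum_telescope u).
apply: is_cvgD; first exact: is_cvg_cst.
apply: normed_cvg; apply: (series_le_cvg _ _ ur) => // [k|].
  by apply: le_trans (normr_ge0 _) (ur k).
exact: is_cvg_geometric_series.
Qed.

(* The weights [4 ^+ k] turn summability of the squared increments into
   geometric decay. *)
Lemma is_cvg_sqr_increments (u : R^nat) :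
  (\sum_(k <oo) (4 ^+ k * (u k.+1 - u k) ^+ 2)%:E < +oo)%E -> cvgn u.
Proof.
set W := (\sum_(k <oo) _)%E => Wlty.
have w0 k : (0 <= (4 ^+ k * (u k.+1 - u k) ^+ 2)%:E)%E.
  by rewrite lee_fin mulr_ge0 ?sqr_ge0 ?exprn_ge0.
have W0 : (0 <= W)%E by apply: nneseries_ge0 => n _ _; exact: w0.
apply: (@is_cvg_geometric_increments _ (Num.sqrt (fine W)) 2^-1) => [|k].
  by rewrite gtr0_norm ?invr_gt0// invf_lt1// ltr1n.
have lew : 4 ^+ k * (u k.+1 - u k) ^+ 2 <= fine W.
  rewrite -lee_fin fineK ?ge0_fin_numE//.
  apply: le_trans (nneseries_lim_ge k.+1 (fun n _ _ => w0 n)).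
  by rewrite big_nat_recr//= leeDr// sume_ge0.
rewrite /geometric /= exprVn ler_pdivlMr ?exprn_gt0//.
rewrite -ler_sqr ?nnegrE ?sqrtr_ge0 ?mulr_ge0 ?exprn_ge0//.
rewrite sqr_sqrtr ?fine_ge0// exprMn real_normK ?num_real// exprAC.
by rewrite mulrC (_ : 2 ^+ 2 = 4 :> R)// -natrX.
Qed.

Lemma ae_cvg_sqr_increments (u : (T -> R)^nat) :
  (forall k, measurable_fun setT (u k)) ->
  (forall k, \int[mu]_x ((u k.+1 x - u k x) ^+ 2)%:E <= (8^-1 ^+ k)%:E)%E ->
  {ae mu, forall x, cvgn (u ^~ x)}.
Proof.
move=> mfu u8; pose w k x := (4 ^+ k * (u k.+1 x - u k x) ^+ 2)%:E.
have mw k : measurable_fun setT (w k).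
  apply/measurable_EFinP; apply: measurable_funM => //.
  by apply: measurable_funX; exact: measurable_funB.
have w0 k x : (0 <= w k x)%E by rewrite lee_fin mulr_ge0 ?sqr_ge0 ?exprn_ge0.
have : (\sum_(k <oo) \int[mu]_x w k x < +oo)%E.
  apply: (@le_lt_trans _ _ 2%:E); last exact: ltry.
  apply: le_trans (epsilon_trick0 xpredT (ler0n R 2)).
  apply: lee_nneseries => [k _ _|k _]; first exact: integral_ge0.
  under eq_integral do rewrite /w EFinM.
  rewrite ge0_integralZl//; last 2 first.
  - by apply/measurable_EFinP; apply: measurable_funX; exact: measurable_funB.
  - by move=> x _; rewrite lee_fin sqr_ge0.
  apply: (@le_trans _ _ ((4 ^+ k)%:E * (8^-1 ^+ k)%:E)%E).
    by rewrite lee_wpmul2l// lee_fin exprn_ge0.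
  rewrite lee_fin natrX exprS invfM mulrA divff// mul1r -exprVn -exprMn.
  by rewrite (_ : 4 / 8 = 2^-1 :> R)//; field.
move=> /(ae_lty_nneseries mw w0); apply: filterS => x.
exact: is_cvg_sqr_increments.
Qed.

Lemma measurable_ae_lim (u : (T -> R)^nat) :
  (forall k, measurable_fun setT (u k)) -> {ae mu, forall x, cvgn (u ^~ x)} ->
  exists2 h : T -> R, measurable_fun setT h &
    {ae mu, forall x, u ^~ x @ \oo --> h x}.
Proof.
move=> mfu cu; exists (fun x => fine (limn_esup (fun k => (u k x)%:E))).
  apply: measurableT_comp => //; apply: measurable_fun_limn_esup => // k.
  exact/measurable_EFinP.
apply: filterS cu => x /cvg_ex[l ul].
have ulE : (u k x)%:E @[k --> \oo] --> l%:E by exact: cvg_EFin (nearW _ _) ul.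
rewrite is_cvg_limn_esupE; last by apply/cvg_ex; exists l%:E.
by rewrite (cvg_lim _ ulE).
Qed.

Lemma ae_fatou_le (f : (T -> \bar R)^nat) (g : T -> \bar R) (M : \bar R) :
  (forall k, measurable_fun setT (f k)) -> measurable_fun setT g ->
  (forall k x, 0 <= f k x)%E -> (forall x, 0 <= g x)%E ->
  {ae mu, forall x, f ^~ x @ \oo --> g x} ->
  (\forall k \near \oo, \int[mu]_x f k x <= M)%E ->
  (\int[mu]_x g x <= M)%E.
Proof.
move=> mf mg f0 g0 fg fM.
have einf_ge0 x : (0 <= limn_einf (f ^~ x))%E.
  rewrite limn_einf_lim; apply: lime_ge; first exact: is_cvg_einfs.
  by apply: nearW => n; apply: le_ereal_inf_tmp => _ [m _ <-].
rewrite (@ge0_ae_eq_integral _ _ _ mu setT g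
  (fun x => limn_einf (f ^~ x)))//; last 2 first.
- rewrite (_ : (fun x => _) = (fun x => - limn_esup (-%E \o (f ^~ x))))%E.
    apply: measurableT_comp => //; apply: measurable_fun_limn_esup => k.
    exact: measurableT_comp.
  by apply/funext => x; rewrite limn_esupN oppeK.
- apply: filterS fg => x fgx _.
  rewrite is_cvg_limn_einfE; last by apply/cvg_ex; exists (g x).
  by apply/esym/cvg_lim.
apply: le_trans (fatou _ _ _ _) _ => //.
rewrite limn_einf_lim; apply: lime_le; first exact: is_cvg_einfs.
have [n _ nM] := fM; apply: nearW => m; apply: le_trans (nM _ (leq_maxl n m)).
by apply: ereal_inf_lbound; exists (maxn n m) => //=; exact: leq_maxr.
Qed.

End ae_convergence.

Section L2_complete.
Context d (T : measurableType d) (R : realType).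
Variable mu : {measure set T -> \bar R}.
Local Notation L2 := (LfunType mu (lee1n 2)).

Lemma L2_fast_cauchy_cvg (u : nat -> L2) :
  (forall k l, (k <= l)%N -> L2_dot (u l - u k) (u l - u k) <= 8^-1 ^+ k) ->
  exists h : L2, forall k, L2_dot (h - u k) (h - u k) <= 8^-1 ^+ k.
Proof.
move=> u8; have mfu k : measurable_fun setT (u k) by [].
have intu k l : (k <= l)%N ->
    (\int[mu]_x ((u l x - u k x) ^+ 2)%:E <= (8^-1 ^+ k)%:E)%E.
  move=> /u8; rewrite -lee_fin EFin_L2_dot.
  by under eq_integral do rewrite -expr2.
have aecu : {ae mu, forall x, cvgn (u ^~ x)}.
  by apply: ae_cvg_sqr_increments => // k; exact: intu.
have [h mh uh] := measurable_ae_lim mfu aecu.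
have inth k : (\int[mu]_x ((h x - u k x) ^+ 2)%:E <= (8^-1 ^+ k)%:E)%E.
  have msq (f g : T -> R) : measurable_fun setT f -> measurable_fun setT g ->
      measurable_fun setT (fun x => ((f x - g x) ^+ 2)%:E).
    by move=> mf mg; apply/measurable_EFinP/measurable_funX/measurable_funB.
  apply: (@ae_fatou_le _ _ _ _ (fun l x => ((u l x - u k x) ^+ 2)%:E)).
  - by move=> l; exact: msq.
  - exact: msq.
  - by move=> l x; rewrite lee_fin sqr_ge0.
  - by move=> x; rewrite lee_fin sqr_ge0.
  - apply: filterS uh => x uhx; apply: cvg_EFin; first exact: nearW.
    have ukx : (fun l => u l x - u k x) @ \oo --> h x - u k x.
      by apply: cvgB => //; exact: cvg_cst.
    exact: (cvgM ukx ukx).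
  - by exists k => // l; exact: intu.
have hu : h - u 0%N \in Lfun mu 2%:E.
  apply: Lfun2_sqr; first exact: measurable_funB.
  by apply: le_lt_trans (inth 0%N) _; exact: ltry.
exists (Lfun_Sub _ hu + u 0%N) => k; rewrite -lee_fin EFin_L2_dot.
apply: le_trans (inth k); under eq_integral do rewrite /= -expr2.
by rewrite subrK.
Qed.

Lemma L2_dot_complete : dot_complete (@L2_dot _ _ _ mu).
Proof.
apply: (fast_cauchy_complete (@L2_dot_ge0 _ _ _ mu) _ L2_fast_cauchy_cvg).
by rewrite invr_gt0 invf_lt1 ?ltr0n ?ltr1n.
Qed.

End L2_complete.

(** * Normal laws on tuples *)

Lemma integral_density d (T : measurableType d) (R : realType)
    (mu nu : {measure set T -> \bar R}) (r : T -> R) :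
  (forall x, 0 <= r x) ->
  (forall h : T -> \bar R, measurable_fun setT h -> (forall x, 0 <= h x)%E ->
    (\int[nu]_x h x = \int[mu]_x (h x * (r x)%:E))%E) ->
  forall f : T -> R, measurable_fun setT f ->
    (\int[nu]_x (f x)%:E = \int[mu]_x (f x * r x)%:E)%E.
Proof.
move=> r0 density f /measurable_EFinP mf; rewrite [LHS]integralE [RHS]integralE.
rewrite !density//; [|exact: measurable_funeneg|exact: measurable_funepos].
congr (_ - _)%E; apply: eq_integral => x _.
  by rewrite !funeposE maxe_pMl ?lee_fin// mul0e.
by rewrite !funenegE maxe_pMl ?lee_fin// mul0e EFinM mulNe.
Qed.

Section normal_tuple.
Context {R : realType}.
Implicit Types (m s t : R).
Local Notation mu := (@lebesgue_measure R).

Lemma ge0_integral_normal_prob m s (f : measurableTypeR R -> \bar R) :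
  measurable_fun [set: measurableTypeR R] f -> (forall t, 0 <= f t)%E ->
  (\int[normal_prob m s]_t f t = \int[mu]_t (f t * (normal_pdf m s t)%:E))%E.
Proof.
move=> mf f0.
have dom := @normal_prob_dominates R m s.
rewrite -(Radon_Nikodym_SigmaFinite.change_of_variables dom)//.
have mpdf : measurable_fun [set: measurableTypeR R]
    (EFin \o normal_pdf m s).
  by apply/measurable_EFinP; exact: measurable_normal_pdf.
have intf := Radon_Nikodym_SigmaFinite.f_integrable dom.
apply: ae_eq_integral => //.
- by apply: emeasurable_funM => //; exact: measurable_int intf.
- exact: emeasurable_funM.
- apply: ae_eqe_mul2l; apply: integral_ae_eq => // A _ mA.
  by rewrite -Radon_Nikodym_SigmaFinite.f_integral.
Qed.

Definition normal_ratio s m m' t : R :=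
  expR ((t * (m' - m)) / s ^+ 2 - (m' ^+ 2 - m ^+ 2) / (2 * s ^+ 2)).

Lemma measurable_normal_ratio s m m' :
  measurable_fun [set: measurableTypeR R] (normal_ratio s m m').
Proof.
apply: measurableT_comp => //; apply: measurable_funB => //.
by apply: measurable_funM => //; exact: measurable_funM.
Qed.

Lemma normal_pdf_ratio s m m' t : s != 0 ->
  normal_ratio s m m' t * normal_pdf m s t = normal_pdf m' s t.
Proof.
move=> s0; rewrite !normal_pdfE// mulrCA; congr (_ * _).
by rewrite /normal_fun /normal_ratio -expRD; congr expR; field.
Qed.

Lemma ge0_integral_normal_ratio s m m' (f : measurableTypeR R -> \bar R) :
  s != 0 ->
  measurable_fun [set: measurableTypeR R] f -> (forall t, 0 <= f t)%E ->
  (\int[normal_prob m' s]_t f t =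
   \int[normal_prob m s]_t (f t * (normal_ratio s m m' t)%:E))%E.
Proof.
move=> s0 mf f0; rewrite [LHS](ge0_integral_normal_prob m' s mf f0).
rewrite [RHS](@ge0_integral_normal_prob m s); last 2 first.
- apply: emeasurable_funM => //.
  by apply/measurable_EFinP; exact: measurable_normal_ratio.
- by move=> t; rewrite mule_ge0// lee_fin expR_ge0.
by apply: eq_integral => t _; rewrite -muleA -EFinM normal_pdf_ratio.
Qed.

(* [measurableTypeR R] and [R] carry the same sigma-algebra under different
   displays: integrals against [normal_prob] live on the former, the
   coordinates of a tuple on the latter. *)
Definition cons_pair n (ty : measurableTypeR R * n.-tuple R) : n.+1.-tuple R :=
  cons_tuple (ty.1 : R) ty.2.

Lemma measurable_cons_pair n :
  measurable_fun [set: measurableTypeR R * n.-tuple R] (@cons_pair n).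
Proof. by apply: measurable_cons => //; exact: measurable_fst. Qed.

HB.instance Definition _ n := isMeasurableFun.Build _ _ _ _ (@cons_pair n)
  (@measurable_cons_pair n).

Lemma measurable_cons_tuple n t :
  measurable_fun [set: n.-tuple R] (fun y => cons_tuple t y).
Proof. exact: measurable_cons. Qed.

Fixpoint normal_tuple_prob s n : n.-tuple R -> probability (n.-tuple R) R :=
  match n return n.-tuple R -> probability (n.-tuple R) R with
  | 0%N => fun=> dirac [tuple]
  | k.+1 => fun m : k.+1.-tuple R =>
      distribution
        (normal_prob (thead m) s \x normal_tuple_prob s (behead_tuple m))%E
        (@cons_pair k)
  end.

Lemma ge0_integral_normal_tuple_prob_cons s n (m : n.+1.-tuple R)
    (f : n.+1.-tuple R -> \bar R) :
  measurable_fun setT f -> (forall y, 0 <= f y)%E ->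
  (\int[normal_tuple_prob s m]_y f y =
   \int[normal_prob (thead m) s]_t
     \int[normal_tuple_prob s (behead_tuple m)]_y f (cons_tuple t y))%E.
Proof.
move=> mf f0; rewrite ge0_integral_pushforward// fubini_tonelli1//.
  exact: (measurableT_comp mf (@measurable_cons_pair n)).
by move=> ty; exact: f0.
Qed.

Lemma measurable_integral_normal_tuple_prob_cons s n (m : n.-tuple R)
    (f : n.+1.-tuple R -> \bar R) :
  measurable_fun setT f -> (forall y, 0 <= f y)%E ->
  measurable_fun [set: measurableTypeR R]
    (fun t => \int[normal_tuple_prob s m]_y f (cons_tuple t y))%E.
Proof.
move=> mf f0.
apply: (@measurable_fun_fubini_tonelli_F _ _ _ _ _ (normal_tuple_prob s m)
  (f \o @cons_pair n)).
  exact: (measurableT_comp mf (@measurable_cons_pair n)).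
by move=> ty; exact: f0.
Qed.

Lemma gintE s n (m : n.-tuple R) (f : n.-tuple R -> \bar R) :
  measurable_fun setT f -> (forall y, 0 <= f y)%E ->
  gint s m f = (\int[normal_tuple_prob s m]_y f y)%E.
Proof.
elim: n m f => [|n IHn] m f mf f0.
  by rewrite /= integral_dirac// diracT mul1e.
rewrite ge0_integral_normal_tuple_prob_cons//; apply: eq_integral => t _.
by apply: IHn => //; exact: (measurableT_comp mf (@measurable_cons_tuple n t)).
Qed.

Definition normal_tuple_ratio s n (m m' y : n.-tuple R) : R :=
  \prod_(i < n) normal_ratio s (tnth m i) (tnth m' i) (tnth y i).

Lemma normal_tuple_ratio_ge0 s n (m m' y : n.-tuple R) :
  0 <= normal_tuple_ratio s m m' y.
Proof. by apply: prodr_ge0 => i _; exact: expR_ge0. Qed.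

Lemma measurable_normal_tuple_ratio s n (m m' : n.-tuple R) :
  measurable_fun setT (normal_tuple_ratio s m m').
Proof.
apply: measurable_prod => i _.
exact: (measurableT_comp (@measurable_normal_ratio _ _ _) (measurable_tnth i)).
Qed.

Lemma normal_tuple_ratio_cons s n (m m' : n.+1.-tuple R) t (y : n.-tuple R) :
  normal_tuple_ratio s m m' (cons_tuple t y) =
  normal_ratio s (thead m) (thead m') t *
  normal_tuple_ratio s (behead_tuple m) (behead_tuple m') y.
Proof.
rewrite /normal_tuple_ratio big_ord_recl; congr (_ * _).
apply: eq_bigr => i _; rewrite !tnth_behead tnthS.
suff -> : lift ord0 i = inord i.+1 by [].
by apply/val_inj; rewrite /= inordK// ltnS.
Qed.

Lemma ge0_integral_normal_tuple_ratio s n (m m' : n.-tuple R)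
    (f : n.-tuple R -> \bar R) :
  s != 0 -> measurable_fun setT f -> (forall y, 0 <= f y)%E ->
  (\int[normal_tuple_prob s m']_y f y =
   \int[normal_tuple_prob s m]_y (f y * (normal_tuple_ratio s m m' y)%:E))%E.
Proof.
move=> s0; elim: n m m' f => [|n IHn] m m' f mf f0.
  by apply: eq_integral => y _; rewrite /normal_tuple_ratio big_ord0 mule1.
have mfr k (p p' : k.-tuple R) (h : k.-tuple R -> \bar R) :
    measurable_fun setT h ->
    measurable_fun setT (fun y => h y * (normal_tuple_ratio s p p' y)%:E)%E.
  move=> mh; apply: emeasurable_funM => //.
  by apply/measurable_EFinP; exact: measurable_normal_tuple_ratio.
have r0 k (p p' y : k.-tuple R) : (0 <= (normal_tuple_ratio s p p' y)%:E)%E.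
  by rewrite lee_fin normal_tuple_ratio_ge0.
rewrite [LHS](ge0_integral_normal_tuple_prob_cons s m' mf f0).
have fr0 y : (0 <= f y * (normal_tuple_ratio s m m' y)%:E)%E.
  by rewrite mule_ge0.
rewrite [RHS](ge0_integral_normal_tuple_prob_cons s m (mfr _ m m' _ mf) fr0).
rewrite [LHS](@ge0_integral_normal_ratio s (thead m) _ _ s0); last 2 first.
- exact: measurable_integral_normal_tuple_prob_cons.
- by move=> t; exact: integral_ge0.
apply: eq_integral => t _.
have mft : measurable_fun setT (fun y : n.-tuple R => f (cons_tuple t y)).
  exact: (measurableT_comp mf (@measurable_cons_tuple n t)).
rewrite (IHn (behead_tuple m) _ _ mft)// muleC.
rewrite -ge0_integralZl ?lee_fin ?expR_ge0//; last 2 first.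
- exact: mfr.
- by move=> y _; rewrite mule_ge0.
by apply: eq_integral => y _; rewrite normal_tuple_ratio_cons EFinM muleCA.
Qed.

Lemma integral_normal_tuple_ratio s n (m m' : n.-tuple R)
    (f : n.-tuple R -> R) :
  s != 0 -> measurable_fun setT f ->
  (\int[normal_tuple_prob s m']_y (f y)%:E =
   \int[normal_tuple_prob s m]_y (f y * normal_tuple_ratio s m m' y)%:E)%E.
Proof.
move=> s0; apply: integral_density; first exact: normal_tuple_ratio_ge0.
by move=> h; exact: ge0_integral_normal_tuple_ratio.
Qed.

End normal_tuple.

Lemma variance_lty_Lfun2 d (T : measurableType d) (R : realType)
    (P : probability T R) (X : T -> R) :
  measurable_fun setT X -> ('V_P[X] < +oo)%E -> X \in Lfun P 2%:E.
Proof.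
move=> mX; rewrite /variance covariance.unlock; set c := fine _.
rewrite expectation.unlock => VX.
have XcL : X \- cst c \in Lfun P 2%:E.
  apply: Lfun2_sqr; first exact: measurable_funB.
  by under eq_integral do rewrite expr2.
rewrite (_ : X = (X \- cst c) + cst c).
  by rewrite rpredD ?(lee1n 2)//= => _; exact: Lfun_cst.
by apply/funext => x; rewrite /= fctE subrK.
Qed.

Section expectation_of_estimators.
Context {R : realType} {N : nat}.
Variable s : R.
Implicit Types (h : 'rV[R]_N -> R) (x : 'rV[R]_N).
Local Notation P x := (normal_tuple_prob s (tup x)).

Lemma ExE x h : estimator h -> Ex s x h = ('E_(P x)[h \o rowt])%E.
Proof.
move=> mh; rewrite expectation.unlock integralE /Ex.
congr (_ - _)%E; rewrite gintE.
- by apply: eq_integral => y _; rewrite funeposE -EFin_max.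
- by apply/measurable_EFinP; exact: measurable_maxr.
- by move=> y; rewrite lee_fin max0_ge0.
- by apply: eq_integral => y _; rewrite funenegE -EFinN -EFin_max.
- by apply/measurable_EFinP/measurable_maxr => //; exact: measurable_funN.
- by move=> y; rewrite lee_fin max0_ge0.
Qed.

Lemma varE x h : estimator h -> var s x h = ('V_(P x)[h \o rowt])%E.
Proof.
move=> mh; rewrite /var ExE; last first.
  by apply: measurable_funX; exact: measurable_funB.
by rewrite ExE// /variance covariance.unlock; congr expectation.
Qed.

End expectation_of_estimators.

(** * Iterated partial derivatives and Hermite polynomials *)

Lemma is_derive_expR_comp (R : realType) (g : R -> R) (z b : R) :
  is_derive z 1 g b -> is_derive z 1 (fun t => expR (g t)) (b * expR (g z)).
Proof.
by move=> dg; rewrite mulrC; exact: (is_derive1_comp (is_derive_expR (g z)) dg).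
Qed.

Lemma is_derive_ffact_exp (R : realType) (n j : nat) (z : R) :
  is_derive z 1 (fun z => (n ^_ j)%:R * z ^+ (n - j))
    ((n ^_ j.+1)%:R * z ^+ (n - j.+1)).
Proof.
rewrite (_ : (fun z => _) = horner ((n ^_ j)%:R *: 'X^(n - j))); last first.
  by apply/funext => t; rewrite hornerZ hornerXn.
rewrite (_ : _ * _ = ((n ^_ j)%:R *: 'X^(n - j))^`().[z]).
  exact: is_derive_poly.
rewrite derivZ derivXn hornerZ hornerMn hornerXn ffactnSr natrM subnS -mulrA.
by rewrite [(n - j)%:R * _]mulr_natl.
Qed.

Lemma is_derive_expRM (R : realType) (w : R) (j : nat) (z : R) :
  is_derive z 1 (fun z => w ^+ j * expR (z * w)) (w ^+ j.+1 * expR (z * w)).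
Proof.
have dM : is_derive z 1 (fun z => z * w) w.
  rewrite (_ : (fun z => _) = horner (w *: 'X)); last first.
    by apply/funext => t; rewrite hornerZ hornerX mulrC.
  rewrite -[X in is_derive _ _ _ X](_ : (w *: 'X)^`().[z] = _).
    exact: is_derive_poly.
  by rewrite derivZ derivX hornerZ hornerC mulr1.
rewrite exprSr -mulrA; exact: (is_deriveZ _ (is_derive_expR_comp dM)).
Qed.

Section partial_derivatives.
Context {R : realType} {N : nat}.
Implicit Types (f g : 'rV[R]_N -> R) (l : 'I_N) (x : 'rV[R]_N)
  (k p q : {ffun 'I_N -> nat}).

Definition set_coord l x (z : R) : 'rV[R]_N :=
  \row_i (if i == l then z else x ord0 i).

Lemma set_coordE l x z i :
  set_coord l x z ord0 i = if i == l then z else x ord0 i.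
Proof. by rewrite mxE. Qed.

Lemma shift_coordE l x t :
  t *: delta_mx ord0 l + x = set_coord l x (t + x ord0 l).
Proof.
apply/rowP => i; rewrite !mxE eqxx /=; case: eqVneq => [->|_].
  by rewrite mulr1.
by rewrite mulr0 add0r.
Qed.

Lemma set_coord_id l x : set_coord l x (x ord0 l) = x.
Proof. by apply/rowP => i; rewrite mxE; case: eqVneq => [->|]. Qed.

Lemma pder_coord l f x (D : R) :
  is_derive (x ord0 l) 1 (fun z => f (set_coord l x z)) D -> pder l f x = D.
Proof.
move=> dg; rewrite -[RHS](@derive_val _ _ _ _ _ _ _ dg) /pder /derive.
apply: (congr1 (fun q : R -> R => lim (q @ 0^'))); apply/funext => t /=.
by rewrite shift_coordE scaler1 set_coord_id.
Qed.

Definition incr_index k l : {ffun 'I_N -> nat} :=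
  [ffun i => (k i + (i == l))%N].

Lemma is_derive_prod_coord l (F : 'I_N -> nat -> R -> R) (C : R) k x (z : R) :
  (forall i j (z : R), is_derive z 1 (F i j) (F i j.+1 z)) ->
  is_derive z 1 (fun z => C * \prod_(i < N) F i (k i) (set_coord l x z ord0 i))
    (C * \prod_(i < N) F i (incr_index k l i) (set_coord l x z ord0 i)).
Proof.
move=> dF.
pose c := C * \prod_(i < N | i != l) F i (k i) (x ord0 i).
rewrite (_ : (fun z => _) = (fun z => c * F l (k l) z)); last first.
  apply/funext => t; rewrite (bigD1 l)//= set_coordE eqxx.
  rewrite /c -mulrA; congr (_ * _); rewrite mulrC; congr (_ * _).
  by apply: eq_bigr => i /negbTE il; rewrite set_coordE il.
rewrite (_ : C * _ = c * F l (k l).+1 z); first exact: is_deriveZ.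
rewrite (bigD1 l)//= ffunE eqxx addn1 set_coordE eqxx.
rewrite /c -mulrA; congr (_ * _); rewrite mulrC; congr (_ * _).
by apply: eq_bigr => i /negbTE il; rewrite ffunE il addn0 set_coordE il.
Qed.

Lemma pder_prod l (F : 'I_N -> nat -> R -> R) (C : R) k x :
  (forall i j (z : R), is_derive z 1 (F i j) (F i j.+1 z)) ->
  pder l (fun x => C * \prod_(i < N) F i (k i) (x ord0 i)) x =
  C * \prod_(i < N) F i (incr_index k l i) (x ord0 i).
Proof.
move=> dF; apply: pder_coord.
by have := is_derive_prod_coord l C k x (x ord0 l) dF; rewrite set_coord_id.
Qed.

Section mder_family.
Variable Phi : {ffun 'I_N -> nat} -> 'rV[R]_N -> R.
Hypothesis pder_Phi : forall k l x, pder l (Phi k) x = Phi (incr_index k l) x.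

Lemma iter_pder_family k l n :
  iter n (pder l) (Phi k) = Phi [ffun i => (k i + n * (i == l))%N].
Proof.
elim: n => [|n IHn] /=.
  by congr Phi; apply/ffunP => i; rewrite ffunE mul0n addn0.
rewrite IHn; apply/funext => x; rewrite pder_Phi; congr (Phi _ _).
by apply/ffunP => i; rewrite !ffunE mulSnr addnA.
Qed.

Lemma mder_family p : mder p (Phi [ffun=> 0%N]) = Phi p.
Proof.
have foldr_family (r : seq 'I_N) :
    foldr (fun l h => iter (p l) (pder l) h) (Phi [ffun=> 0%N]) r =
    Phi [ffun i => (p i * count_mem i r)%N].
  elim: r => [|l r IHr] /=.
    by congr Phi; apply/ffunP => i; rewrite !ffunE muln0.
  rewrite IHr iter_pder_family; congr Phi; apply/ffunP => i; rewrite !ffunE.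
  rewrite mulnDr addnC eq_sym; congr (_ + _)%N.
  by case: eqVneq => [->|]; rewrite ?muln0.
rewrite /mder foldr_family; congr Phi; apply/ffunP => i; rewrite !ffunE.
by rewrite count_uniq_mem ?enum_uniq// mem_enum muln1.
Qed.

End mder_family.

Lemma mder_prod (F : 'I_N -> nat -> R -> R) (C : R) p x :
  (forall i j (z : R), is_derive z 1 (F i j) (F i j.+1 z)) ->
  mder p (fun x => C * \prod_(i < N) F i 0%N (x ord0 i)) x =
  C * \prod_(i < N) F i (p i) (x ord0 i).
Proof.
move=> dF; pose Phi k x := C * \prod_(i < N) F i (k i) (x ord0 i).
have -> : (fun x => C * \prod_(i < N) F i 0%N (x ord0 i)) = Phi [ffun=> 0%N].
  by apply/funext => y; congr (C * _); apply: eq_bigr => i _; rewrite ffunE.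
by rewrite (mder_family (Phi := Phi))// => k l y; exact: pder_prod.
Qed.

Lemma eq_mder_support p f g :
  (forall x, (forall l, p l = 0%N -> x ord0 l = 0) -> f x = g x) ->
  mder p f 0 = mder p g 0.
Proof.
move=> fg; pose Z x := forall l, p l = 0%N -> x ord0 l = 0.
have pder_local l f1 g1 : p l != 0%N -> (forall x, Z x -> f1 x = g1 x) ->
    forall x, Z x -> pder l f1 x = pder l g1 x.
  move=> pl fg1 x Zx; apply: (congr1 (fun q : R -> R => lim (q @ 0^'))).
  apply/funext => t /=; rewrite !fg1// => l' pl'.
  rewrite shift_coordE set_coordE; case: eqVneq => [ll'|_]; last exact: Zx.
  by move: pl; rewrite -ll' pl'.
suff foldr_local (r : seq 'I_N) : forall x, Z x ->
    foldr (fun l h => iter (p l) (pder l) h) f r x =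
    foldr (fun l h => iter (p l) (pder l) h) g r x.
  by apply: foldr_local => l _; rewrite mxE.
elim: r => [|l r IHr] //=; have [->//|pl] := eqVneq (p l) 0%N.
by elim: {1 2}(p l) => [//|n IHn] /=; exact: pder_local.
Qed.

Lemma mder_mpow p q : mder p (fun x : 'rV[R]_N => mpow x q) 0 =
  (p == q)%:R * (mfact p)%:R.
Proof.
pose F (i : 'I_N) j (z : R) := (q i ^_ j)%:R * z ^+ (q i - j).
have -> : (fun x : 'rV[R]_N => mpow x q) =
    (fun x => 1 * \prod_(i < N) F i 0%N (x ord0 i)).
  apply/funext => x; rewrite mul1r; apply: eq_bigr => i _.
  by rewrite /F ffactn0 subn0 mul1r.
have dF i j (z : R) : is_derive z 1 (F i j) (F i j.+1 z).
  exact: is_derive_ffact_exp.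
rewrite (mder_prod _ _ _ dF).
rewrite mul1r /F; have [->|pq] := eqVneq p q.
  rewrite mul1r /mfact natr_prod; apply: eq_bigr => i _.
  by rewrite subnn expr0 mulr1 ffactnn.
have [i pqi] : exists i, p i != q i.
  apply/existsP; apply: contraR pq => /existsPn eqpq.
  by apply/eqP/ffunP => i; apply/eqP; rewrite -[_ == _]negbK.
rewrite mul0r (bigD1 i)//= mxE; case: (ltngtP (p i) (q i)) pqi => // [lt|gt] _.
  by rewrite expr0n subn_eq0 leqNgt lt mulr0 mul0r.
by rewrite ffact_small// !mul0r.
Qed.

Lemma mder_expR_dotv p (z : 'rV[R]_N) :
  mder p (fun x => expR (dotv x z)) 0 = mpow z p.
Proof.
pose F (i : 'I_N) j t := z ord0 i ^+ j * expR (t * z ord0 i).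
have -> : (fun x => expR (dotv x z)) =
    (fun x => 1 * \prod_(i < N) F i 0%N (x ord0 i)).
  apply/funext => x; rewrite mul1r expR_sum; apply: eq_bigr => i _.
  by rewrite /F expr0 mul1r.
have dF i j (t : R) : is_derive t 1 (F i j) (F i j.+1 t).
  exact: is_derive_expRM.
rewrite (mder_prod _ _ _ dF).
by rewrite mul1r; apply: eq_bigr => i _; rewrite /F mxE mul0r expR0 mulr1.
Qed.

End partial_derivatives.

Section hermite.
Context {R : realType}.

Fixpoint hermite n : {poly R} :=
  if n is n'.+1 then 'X * hermite n' - (hermite n')^`() else 1.

Definition hermite_exp (w : R) n z : R :=
  (hermite n).[w - z] * expR (w * z - z ^+ 2 / 2).

Lemma is_derive_hermite_exp (w : R) n (z : R) :
  is_derive z 1 (hermite_exp w n) (hermite_exp w n.+1 z).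
Proof.
pose A := hermite n \Po (w%:P - 'X); pose B := w *: 'X - 2^-1 *: 'X^2.
have BE t : B.[t] = w * t - t ^+ 2 / 2.
  by rewrite /B hornerD hornerN !hornerZ hornerX hornerXn (mulrC 2^-1).
have AE t : A.[t] = (hermite n).[w - t].
  by rewrite /A horner_comp !hornerE.
rewrite (_ : hermite_exp w n = (fun t => A.[t] * expR B.[t])); last first.
  by apply/funext => t; rewrite AE BE.
have dA := is_derive_poly A z.
have dB := is_derive_expR_comp (is_derive_poly B z).
rewrite (_ : hermite_exp w n.+1 z =
  A.[z] *: (B^`().[z] * expR B.[z]) + expR B.[z] *: A^`().[z]).
  exact: (is_deriveM dA dB).
rewrite BE AE /hermite_exp /= /GRing.scale /=.
have -> : A^`().[z] = - (hermite n)^`().[w - z].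
  rewrite /A deriv_comp derivB derivC derivX !hornerE horner_comp !hornerE.
  by ring.
have -> : B^`().[z] = w - z.
  by rewrite /B derivB !derivZ derivX derivXn !hornerE; field.
by rewrite hornerD hornerN hornerM hornerX; ring.
Qed.

Lemma horner_expR_bound (p : {poly R}) :
  exists2 K : R, 0 <= K & forall z, `|p.[z]| <= K * expR `|z|.
Proof.
exists (\sum_(i < size p) `|p`_i| * i`!%:R).
  by apply: sumr_ge0 => i _; rewrite mulr_ge0.
move=> z; rewrite horner_coef; apply: le_trans (ler_norm_sum _ _ _) _.
rewrite mulr_suml; apply: ler_sum => i _; rewrite normrM -mulrA.
rewrite ler_wpM2l// normrX -ler_pdivrMl ?ltr0n ?fact_gt0// mulrC.
case: (nat_of_ord i) => [|n].
  by rewrite expr0 fact0 divr1 -expR0 ler_expR.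
by apply: le_trans (expR_ge1Dxn n (normr_ge0 z)); rewrite lerDr.
Qed.

End hermite.

Lemma hermite_exp_le_expR (R : realType) n (r : R) : 0 <= r ->
  exists2 K : R, 0 <= K & forall w z, `|z| <= r ->
    `|hermite_exp w n z| <= K * (expR ((r + 1) * w) + expR (- (r + 1) * w)).
Proof.
move=> r0; have [K K0 KP] := horner_expR_bound (hermite n : {poly R}).
exists (K * expR r); first by rewrite mulr_ge0// expR_ge0.
move=> w z zr; rewrite normrM [X in _ * X]ger0_norm ?expR_ge0//.
apply: (@le_trans _ _ (K * expR (`|w| + r) * expR (r * `|w|))).
  apply: ler_pM => //.
    apply: le_trans (KP _) _; rewrite ler_wpM2l// ler_expR.
    by apply: le_trans (ler_normB _ _) _; rewrite lerD2l.
  rewrite ler_expR; apply: (@le_trans _ _ (w * z)).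
    by rewrite gerBl divr_ge0 ?sqr_ge0.
  by apply: le_trans (ler_norm _) _; rewrite normrM mulrC ler_wpM2r.
rewrite -!mulrA; apply: ler_wpM2l => //.
rewrite -expRD (_ : `|w| + r + r * `|w| = r + (r + 1) * `|w|); last by ring.
rewrite expRD; apply: ler_wpM2l; first exact: expR_ge0.
have [w0|w0] := lerP 0 w.
  by rewrite ger0_norm// lerDl expR_ge0.
by rewrite ltr0_norm// mulrN -mulNr lerDr expR_ge0.
Qed.

Lemma hermite_exp_bound (R : realType) n (r : R) : 0 <= r ->
  exists2 K : R, 0 <= K & forall w z, `|z| <= r ->
    `|hermite_exp w n z| <=
    K * \sum_(b : bool) hermite_exp w 0 ((-1) ^+ b * (r + 1)).
Proof.
move=> r0; have [K K0 leK] := hermite_exp_le_expR n r0.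
have expRE (w z : R) : expR (z * w) = expR (z ^+ 2 / 2) * hermite_exp w 0 z.
  by rewrite /hermite_exp /= hornerC mul1r -expRD; congr expR; ring.
exists (K * expR ((r + 1) ^+ 2 / 2)) => [|w z /leK/le_trans].
  by rewrite mulr_ge0// expR_ge0.
apply; rewrite -mulrA ler_wpM2l// big_bool/= expr1 expr0 mulN1r mul1r mulrDr.
by rewrite addrC (expRE w (r + 1)) (expRE w (- (r + 1))) sqrrN.
Qed.

(** * The kernel psi in L2 *)

Lemma is_derive_Rintegral d (T : measurableType d) (R : realType)
    (mu : {measure set T -> \bar R}) (f f' : R -> T -> R) (G : T -> R)
    (a r : R) :
  0 < r ->
  (forall t, ball a r t -> mu.-integrable setT (EFin \o f t)) ->
  (forall (t : R) y, is_derive t 1 (f ^~ y) (f' t y)) ->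
  mu.-integrable setT (EFin \o G) ->
  (forall t y, ball a r t -> `|f' t y| <= G y) ->
  is_derive a 1 (fun t => \int[mu]_y f t y) (\int[mu]_y f' a y).
Proof.
move=> r0 intf df intG f'G; rewrite ball_itv in intf f'G.
have Ia : `]a - r, a + r[%classic a by rewrite /= in_itv/=; lra.
have d1f t y : partial1of2 f t y = f' t y.
  by rewrite partial1of2E (@derive_val _ _ _ _ _ _ _ (df t y)).
have der t y : `]a - r, a + r[%classic t -> setT y -> derivable (f ^~ y) t 1.
  by move=> _ _; exact: (@ex_derive _ _ _ _ _ _ _ (df t y)).
have G0 y : 0 <= G y by exact: le_trans (normr_ge0 _) (f'G a y Ia).
have ubG t y : `]a - r, a + r[%classic t -> setT y ->
    `|partial1of2 f t y| <= G y.
  by move=> ar _; rewrite d1f; exact: f'G.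
split.
  exact: (derivable_under_integral measurableT Ia intf der G0 intG ubG).
rewrite -derive1E.
rewrite (differentiation_under_integral measurableT Ia intf der G0 intG ubG).
by apply: eq_Rintegral => y _; rewrite d1f.
Qed.

Lemma measurable_horner_real (R : realType) (p : {poly R}) :
  measurable_fun [set: R] (horner p).
Proof. by apply: continuous_measurable_fun; exact: continuous_horner. Qed.

Section psi_kernel.
Context {R : realType} {N : nat}.
Variables (s : R) (x0 : 'rV[R]_N).
Hypothesis s_neq0 : s != 0.
Implicit Types (x z : 'rV[R]_N) (k p q : {ffun 'I_N -> nat}).
Local Notation P0 := (normal_tuple_prob s (tup x0)).
Local Notation L2 := (LfunType P0 (lee1n 2)).

(* [psi] is the Hermite generating function, up to a factor free of [x]. *)
Definition psi_der k x (y : 'rV[R]_N) : R :=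
  expR (- dotv y x0 / s ^+ 2) *
  \prod_(l < N) hermite_exp ((y ord0 l + x0 ord0 l) / s) (k l) (x ord0 l).

Lemma psi_derE x y : psi s x0 x y = psi_der [ffun=> 0%N] x y.
Proof.
rewrite /psi_der /psi.
under eq_bigr do rewrite ffunE /hermite_exp /= hornerC mul1r.
rewrite -expR_sum -expRD; congr expR.
rewrite /dotv -sumrN !mulr_suml -sumrN -!big_split /=.
by apply: eq_bigr => l _; rewrite !mxE; field.
Qed.

Lemma mder_psi p y : mder p (fun x => psi s x0 x y) 0 = psi_der p 0 y.
Proof.
under eq_fun do rewrite psi_derE /psi_der.
under eq_fun do under eq_bigr do rewrite ffunE.
apply: (@mder_prod _ _ (fun i => hermite_exp ((y ord0 i + x0 ord0 i) / s))).
by move=> i j t; exact: is_derive_hermite_exp.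
Qed.

Lemma normal_tuple_ratio_nu x (y : N.-tuple R) :
  normal_tuple_ratio s (tup x0) (tup x) y * nu s x0 x =
  psi s x0 (s^-1 *: x) (rowt y).
Proof.
rewrite /normal_tuple_ratio /nu /psi -expR_sum -expRD; congr expR.
rewrite /dotv -sumrN !mulr_suml -sumrN -!big_split /=.
by apply: eq_bigr => l _; rewrite !tnth_mktuple !mxE; field.
Qed.

Lemma psiM x z (y : N.-tuple R) :
  psi s x0 x (rowt y) * psi s x0 z (rowt y) =
  expR (dotv x z) * normal_tuple_ratio s (tup x0) (tup (s *: (x + z) - x0)) y.
Proof.
rewrite /normal_tuple_ratio /psi -expR_sum -!expRD; congr expR.
rewrite /dotv !mulr_suml -!sumrN -!big_split /=.
by apply: eq_bigr => l _; rewrite !tnth_mktuple !mxE; field.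
Qed.

Lemma measurable_psi_der k x :
  measurable_fun setT (fun y : N.-tuple R => psi_der k x (rowt y)).
Proof.
have measurable_coord l :
    measurable_fun setT (fun y : N.-tuple R => rowt y ord0 l).
  rewrite (_ : (fun y => _) = fun y : N.-tuple R => tnth y l).
    exact: measurable_tnth.
  by apply/funext => y; rewrite mxE.
apply: measurable_funM.
  apply: measurableT_comp => //; apply: measurable_funM => //.
  apply: measurableT_comp => //; apply: measurable_sum => l.
  exact: measurable_funM.
apply: measurable_prod => l _.
have mw : measurable_fun setT
    (fun y : N.-tuple R => (rowt y ord0 l + x0 ord0 l) / s).
  by apply: measurable_funM => //; exact: measurable_funD.
apply: measurable_funM.
  apply: (measurableT_comp (measurable_horner_real _)).
  exact: measurable_funB.
apply: measurableT_comp => //; apply: measurable_funB => //.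
exact: measurable_funM.
Qed.

Definition corner (B : R) (e : {ffun 'I_N -> bool}) : 'rV[R]_N :=
  \row_l ((-1) ^+ e l * B).

Definition psi_corners (B : R) (y : 'rV[R]_N) : R :=
  \sum_(e : {ffun 'I_N -> bool}) psi s x0 (corner B e) y.

(* Expanding the product over the coordinates of the two-term bounds of
   [hermite_exp_bound] gives a sum over the corners of a cube. *)
Lemma psi_der_bound k (r : R) : 0 <= r ->
  exists2 K : R, 0 <= K & forall x y, (forall l, `|x ord0 l| <= r) ->
    `|psi_der k x y| <= K * psi_corners (r + 1) y.
Proof.
move=> r0.
have /choice[K KP] (l : 'I_N) : exists K : R,
    0 <= K /\ forall w z : R, `|z| <= r ->
    `|hermite_exp w (k l) z| <=
    K * \sum_(b : bool) hermite_exp w 0 ((-1) ^+ b * (r + 1)).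
  by have [K K0 leK] := hermite_exp_bound (k l) r0; exists K.
have prodK0 : 0 <= \prod_l K l by apply: prodr_ge0 => l _; exact: (KP l).1.
exists (\prod_l K l) => // x y xr.
rewrite /psi_der normrM (ger0_norm (expR_ge0 _)) normr_prod.
apply: (@le_trans _ _ (expR (- dotv y x0 / s ^+ 2) * \prod_(l < N) (K l *
    \sum_(b : bool) hermite_exp ((y ord0 l + x0 ord0 l) / s) 0
      ((-1) ^+ b * (r + 1))))).
  apply: ler_wpM2l; first exact: expR_ge0.
  by apply: ler_prod => l _; rewrite normr_ge0 (KP l).2.
rewrite big_split/= bigA_distr_bigA/= mulrCA; apply: ler_wpM2l => //.
rewrite mulr_sumr; apply: ler_sum => e _; rewrite psi_derE /psi_der.
by under [in leRHS]eq_bigr do rewrite ffunE mxE.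
Qed.

Lemma integral_normal_tuple_ratio1 (m : N.-tuple R) :
  (\int[P0]_y (normal_tuple_ratio s (tup x0) m y)%:E = 1)%E.
Proof.
have m1 : measurable_fun [set: N.-tuple R] (cst 1 : _ -> R) by [].
rewrite -(expectation_cst (normal_tuple_prob s m) 1) expectation.unlock.
rewrite (integral_normal_tuple_ratio (tup x0) m s_neq0 m1).
by apply: eq_integral => y _; rewrite mul1r.
Qed.

Lemma integral_psiM x z :
  (\int[P0]_y (psi s x0 x (rowt y) * psi s x0 z (rowt y))%:E =
   (expR (dotv x z))%:E)%E.
Proof.
under eq_integral do rewrite psiM EFinM.
rewrite ge0_integralZl//.
- by rewrite integral_normal_tuple_ratio1 mule1.
- by apply/measurable_EFinP; exact: measurable_normal_tuple_ratio.
- by move=> y _; rewrite lee_fin normal_tuple_ratio_ge0.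
Qed.

Lemma Lfun2_psi x : (fun y => psi s x0 x (rowt y)) \in Lfun P0 2%:E.
Proof.
apply: Lfun2_sqr.
  by under eq_fun do rewrite psi_derE; exact: measurable_psi_der.
by under eq_integral do rewrite expr2; rewrite integral_psiM ltry.
Qed.

Lemma Lfun2_psi_corners (B : R) :
  (fun y => psi_corners B (rowt y)) \in Lfun P0 2%:E.
Proof.
rewrite (_ : (fun y => _) = \sum_e (fun y => psi s x0 (corner B e) (rowt y))).
  by rewrite rpred_sum ?(lee1n 2)//= => _ e _; exact: Lfun2_psi.
by apply/funext => y; rewrite fct_sumE.
Qed.

Lemma Lfun2_psi_der k x : (fun y => psi_der k x (rowt y)) \in Lfun P0 2%:E.
Proof.
pose r := \sum_l `|x ord0 l|; have r0 : 0 <= r by exact: sumr_ge0.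
have [K K0 leK] := psi_der_bound k r0.
apply: (@le_Lfun2 _ _ _ _ _ (fun y => psi_corners (r + 1) (rowt y) * K)).
- exact: measurable_psi_der.
- move=> y; rewrite mulrC; apply: leK => l; rewrite /r (bigD1 l)//= lerDl.
  exact: sumr_ge0.
- exact: (Lfun_scale K (ler1n R 2) (Lfun2_psi_corners _)).
Qed.

Definition psi_der_L2 k x : L2 := Lfun_Sub (lee1n 2) (Lfun2_psi_der k x).
Definition psi_L2 x : L2 := psi_der_L2 [ffun=> 0%N] x.

Lemma psi_L2E x y : psi_L2 x y = psi s x0 x (rowt y).
Proof. by rewrite psi_derE. Qed.

Lemma L2_dot_psi x z : L2_dot (psi_L2 x) (psi_L2 z) = expR (dotv x z).
Proof.
apply: EFin_inj; rewrite -integral_psiM EFin_L2_dot.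
by apply: eq_integral => y _; rewrite !psi_L2E.
Qed.

Lemma set_coord_bound l x t i : `|t - x ord0 l| < 1 ->
  `|set_coord l x t ord0 i| <= \sum_j `|x ord0 j| + 1.
Proof.
move=> tx; rewrite set_coordE; case: ifPn => _.
  rewrite -[t](subrK (x ord0 l)) addrC (le_trans (ler_normD _ _))//.
  by apply: lerD; [rewrite (bigD1 l)//= lerDl sumr_ge0|exact: ltW].
by rewrite (bigD1 i)//= -addrA lerDl addr_ge0// sumr_ge0.
Qed.

Lemma pder_L2_dot_psi_der (f : L2) k l x :
  pder l (fun x => L2_dot f (psi_der_L2 k x)) x =
  L2_dot f (psi_der_L2 (incr_index k l) x).
Proof.
apply: pder_coord; set k' := incr_index k l.
pose r := \sum_i `|x ord0 i| + 1.
have r0 : 0 <= r by rewrite addr_ge0// sumr_ge0.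
have [K K0 leK] := psi_der_bound k' r0.
have corners := Lfun_scale K (ler1n R 2) (Lfun2_psi_corners (r + 1)).
pose G y := `|f y * (psi_corners (r + 1) (rowt y) * K)|.
rewrite -[X in L2_dot f (psi_der_L2 k' X)](set_coord_id l).
apply: (@is_derive_Rintegral _ _ _ _ _
  (fun t y => f y * psi_der k' (set_coord l x t) (rowt y)) G _ 1).
- exact: ltr01.
- by move=> t _; exact: (integrable_L2M f (psi_der_L2 k (set_coord l x t))).
- move=> t y; apply: is_deriveZ.
  apply: (@is_derive_prod_coord _ _ l
    (fun i => hermite_exp ((rowt y ord0 i + x0 ord0 i) / s))) => i j u.
  exact: is_derive_hermite_exp.
- exact: (integrable_norm (integrable_L2M f (Lfun_Sub (lee1n 2) corners))).
- move=> t y tx; rewrite /G normrM [leRHS]normrM ler_wpM2l// mulrC.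
  apply: le_trans (ler_norm _); apply: leK => i.
  by apply: set_coord_bound; rewrite distrC.
Qed.

Lemma mder_L2_dot_psi (f : L2) p :
  mder p (fun x => L2_dot f (psi_L2 x)) 0 = L2_dot f (psi_der_L2 p 0).
Proof.
rewrite (@mder_family _ _ (fun k x => L2_dot f (psi_der_L2 k x)))// => k l x.
exact: pder_L2_dot_psi_der.
Qed.

Lemma L2_dot_psi_psi_der x p : L2_dot (psi_L2 x) (psi_der_L2 p 0) = mpow x p.
Proof.
rewrite -mder_L2_dot_psi -mder_expR_dotv; congr (mder _ _ _).
by apply/funext => z; rewrite L2_dotC L2_dot_psi.
Qed.

Lemma L2_dot_psi_der p q :
  L2_dot (psi_der_L2 q 0) (psi_der_L2 p 0) = (p == q)%:R * (mfact p)%:R.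
Proof.
rewrite -mder_L2_dot_psi -mder_mpow; congr (mder _ _ _).
by apply/funext => z; rewrite L2_dotC L2_dot_psi_psi_der.
Qed.

End psi_kernel.

(** * Power series of the exponential on sparse vectors *)

Section sparse_exponential.
Context {R : realType} {N : nat}.
Implicit Types (x z : 'rV[R]_N) (p : {ffun 'I_N -> nat}) (S : nat).

Lemma mfact_gt0 p : 0 < (mfact p)%:R :> R.
Proof. by rewrite ltr0n prodn_gt0// => l; rewrite fact_gt0. Qed.

Lemma expR_le_esum (a : 'I_N -> R) : (forall l, 0 <= a l) ->
  ((expR (\sum_l a l))%:E <= \esum_(p in [set: {ffun 'I_N -> nat}])
     ((\prod_l a l ^+ p l) / (mfact p)%:R)%:E)%E.
Proof.
move=> a0.
pose box n (f : {ffun 'I_N -> 'I_n}) : {ffun 'I_N -> nat} :=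
  [ffun l => val (f l)].
have box_inj n : injective (@box n).
  move=> f g /ffunP fg; apply/ffunP => l; apply/val_inj.
  by have := fg l; rewrite !ffunE.
have partial_sum n : ((\prod_l series (exp_coeff (a l)) n)%:E <=
    \esum_(p in [set: {ffun 'I_N -> nat}])
      ((\prod_l a l ^+ p l) / (mfact p)%:R)%:E)%E.
  apply: esum_ge; exists [set` map (@box n) (enum {ffun 'I_N -> 'I_n})].
    by split=> //; exact: finite_seq.
  have uniq_box : uniq (map (@box n) (enum {ffun 'I_N -> 'I_n})).
    by rewrite (map_inj_uniq (@box_inj n)) enum_uniq.
  rewrite -fsbig_seq// big_map big_enum/= sumEFin lee_fin.
  under eq_bigr do rewrite /series/= big_mkord.
  rewrite bigA_distr_bigA/=; apply: ler_sum => f _.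
  rewrite /mfact natr_prod -prodf_div.
  by under [in leRHS]eq_bigr do rewrite ffunE.
have cvg_partial : \prod_l series (exp_coeff (a l)) n @[n --> \oo] -->
    expR (\sum_l a l).
  rewrite expR_sum; apply: cvg_big => [|l _]; first exact: mul_continuous.
  exact: is_cvg_series_exp_coeff.
have cvg_partialE : (\prod_l series (exp_coeff (a l)) n)%:E @[n --> \oo] -->
    (expR (\sum_l a l))%:E.
  by apply: cvg_EFin; [exact: nearW|exact: cvg_partial].
rewrite -(cvg_lim _ cvg_partialE)//; apply: lime_le; last exact: nearW.
by apply/cvg_ex; eexists; exact: cvg_partialE.
Qed.

Lemma card_support (T : finType) (Q : pred T) :
  #|[set l | Q l]%classic| = #|[pred l | Q l]|.
Proof.
by apply: eq_card => l; apply/idP/idP => [/set_mem|] //= Ql; exact: mem_set.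
Qed.

Lemma sub_XS S x z : (forall l, x ord0 l = 0 -> z ord0 l = 0) ->
  XS N S x -> XS N S z.
Proof.
move=> xz; apply: leq_trans; rewrite !card_support.
apply: subset_leq_card; apply/fintype.subsetP => l; rewrite !inE.
by apply: contra => /eqP/xz ->.
Qed.

Lemma MI_XS S p x : (forall l, p l = 0%N -> x ord0 l = 0) ->
  MI N S p -> XS N S x.
Proof.
move=> px; apply: leq_trans; rewrite !card_support.
apply: subset_leq_card; apply/fintype.subsetP => l; rewrite !inE.
by apply: contra => /eqP/px ->.
Qed.

Lemma mpow_notin_MI S x p : XS N S x -> ~ MI N S p -> mpow x p = 0.
Proof.
move=> xS; apply: contra_notP => /eqP xp; apply: leq_trans xS.
rewrite !card_support; apply: subset_leq_card; apply/fintype.subsetP => l.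
rewrite !inE; apply: contra => /eqP xl; apply: contraR xp => pl.
by rewrite /mpow (bigD1 l)//= xl expr0n (negbTE pl) mul0r.
Qed.

Lemma expR_dotv_le_esum S x : XS N S x ->
  ((expR (dotv x x))%:E <=
   \esum_(p in MI N S) (mpow x p ^+ 2 / (mfact p)%:R)%:E)%E.
Proof.
move=> xS; rewrite esum_mkcond.
apply: le_trans (expR_le_esum (fun l => sqr_ge0 (x ord0 l))) _.
apply: le_esum => p _; rewrite -prodrXl.
under eq_bigr do rewrite exprAC.
rewrite prodrXl -/(mpow x p).
case: ifPn => // pS; rewrite (mpow_notin_MI xS) ?expr0n ?mul0r//.
by apply/negP; apply: contra pS; exact: mem_set.
Qed.

End sparse_exponential.

(** * Locally minimum variance estimators *)

Lemma eq_ssum (R : realType) (I : choiceType) (D : set I) (u v : I -> R) :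
  (forall i, D i -> u i = v i) -> ssum D u = ssum D v.
Proof. by move=> uv; congr (_ - _)%E; apply: eq_esum => i Di; rewrite uv. Qed.

Section lmv.
Context {R : realType} {N : nat}.
Variables (S : nat) (s : R) (x0 : 'rV[R]_N).
Hypothesis s_neq0 : s != 0.
Implicit Types (p q : {ffun 'I_N -> nat}) (x : 'rV[R]_N).
Implicit Types (h g c gam : 'rV[R]_N -> R).
Local Notation P0 := (normal_tuple_prob s (tup x0)).
Local Notation L2 := (LfunType P0 (lee1n 2)).
Local Notation psi_L2 := (psi_L2 x0 s_neq0).
Implicit Type f : L2.

Let dot_ge0 := @L2_dot_ge0 _ _ _ P0.

Definition hermite_basis p : L2 :=
  (Num.sqrt (mfact p)%:R)^-1 *: psi_der_L2 x0 s_neq0 p 0.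

Lemma hermite_basis_orthonormal p q :
  L2_dot (hermite_basis p) (hermite_basis q) = (p == q)%:R.
Proof.
rewrite L2_dotZr L2_dotC L2_dotZr L2_dot_psi_der.
have [->|_] := eqVneq p q; last by rewrite mul0r !mulr0.
by rewrite mul1r mulrA -invfM -expr2 sqr_sqrtr ?mulVf ?gt_eqF ?mfact_gt0.
Qed.

Lemma L2_dot_psi_hermite_basis x p :
  L2_dot (psi_L2 x) (hermite_basis p) = mpow x p / Num.sqrt (mfact p)%:R.
Proof. by rewrite L2_dotZr L2_dot_psi_psi_der mulrC. Qed.

Lemma esum_psi_hermite_basis x : XS N S x ->
  \esum_(p in MI N S) (L2_dot (psi_L2 x) (hermite_basis p) ^+ 2)%:E =
  (L2_dot (psi_L2 x) (psi_L2 x))%:E.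
Proof.
move=> xS; apply/eqP; rewrite eq_le (bessel dot_ge0)/=; last first.
  exact: hermite_basis_orthonormal.
rewrite L2_dot_psi; apply: le_trans (expR_dotv_le_esum xS) _.
apply: le_esum => p _; rewrite L2_dot_psi_hermite_basis exprMn exprVn.
by rewrite sqr_sqrtr// ltW// mfact_gt0.
Qed.

Lemma ssum_L2_dot_psi f x : XS N S x ->
  ssum (MI N S) (fun p => L2_dot f (hermite_basis p) / Num.sqrt (mfact p)%:R *
    mpow x p) = (L2_dot f (psi_L2 x))%:E.
Proof.
move=> /esum_psi_hermite_basis full.
have <- := parseval dot_ge0 hermite_basis_orthonormal f full.
apply: eq_ssum => p _ /=; rewrite L2_dot_psi_hermite_basis.
by rewrite mulrAC mulrA.
Qed.

Section mean_and_variance.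
Variables (h : 'rV[R]_N -> R) (f : L2).
Hypothesis hf : h \o rowt = f.

Lemma estimator_L2 : estimator h.
Proof. by rewrite /estimator -[X in measurable_fun _ X]/(h \o rowt) hf. Qed.

Lemma Ex_psi x : Ex s x h =
  ((nu s x0 x)^-1 * L2_dot f (psi_L2 (s^-1 *: x)))%:E.
Proof.
rewrite (ExE _ _ estimator_L2) expectation.unlock hf.
rewrite (integral_normal_tuple_ratio (tup x0))//.
rewrite -L2_dotZr EFin_L2_dot; apply: eq_integral => y _; congr (_ * _)%:E.
rewrite -[RHS]/((nu s x0 x)^-1 * psi_L2 (s^-1 *: x) y) psi_L2E.
rewrite -normal_tuple_ratio_nu//.
by rewrite mulrCA mulVf ?mulr1// gt_eqF// expR_gt0.
Qed.

Lemma Ex_sqr : Ex s x0 (fun y => h y ^+ 2) = (L2_dot f f)%:E.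
Proof.
rewrite ExE; last first.
  by apply: measurable_funX; exact: estimator_L2.
rewrite expectation.unlock EFin_L2_dot; apply: eq_integral => y _.
by rewrite -hf -expr2.
Qed.

Lemma var_L2 (k : R) : Ex s x0 h = k%:E ->
  var s x0 h = (L2_dot f f - k ^+ 2)%:E.
Proof.
rewrite (ExE _ _ estimator_L2) (varE _ _ estimator_L2) hf => Ek.
rewrite varianceE ?LfunP// Ek EFinB -Ex_sqr ExE; last first.
  by apply: measurable_funX; exact: estimator_L2.
by congr (_ - _)%E; rewrite -hf.
Qed.

End mean_and_variance.

Definition reproduces gam f := forall x, XS N S x ->
  gam x = (nu s x0 x)^-1 * L2_dot f (psi_L2 (s^-1 *: x)).

Lemma admissibleP g c h : admissible S s g c x0 h <->
  exists2 f : L2, h \o rowt = f & reproduces (fun x => c x + g x) f.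
Proof.
split=> [[mh vh Eh]|[f hf rf]].
  have hL : h \o rowt \in Lfun P0 2%:E.
    by apply: variance_lty_Lfun2 => //; rewrite -varE.
  exists (Lfun_Sub (lee1n 2) hL) => // x xS.
  by apply: EFin_inj; rewrite -(@Ex_psi h) ?Eh.
split; first exact: estimator_L2 hf.
  by rewrite (var_L2 hf (Ex_psi hf x0)) ltry.
by move=> x xS; rewrite (Ex_psi hf) -rf.
Qed.

Lemma acoef_L2_dot gam f p : reproduces gam f -> MI N S p ->
  acoef s gam x0 p = L2_dot f (hermite_basis p).
Proof.
move=> rf pS; rewrite L2_dotZr -mder_L2_dot_psi /acoef; congr (_ * _).
apply: eq_mder_support => x xp.
have xS : XS N S (s *: x).
  by apply: MI_XS pS => l /xp; rewrite mxE => ->; rewrite mulr0.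
rewrite rf// scalerA mulVf// scale1r mulrC mulrA divff ?mul1r//.
by rewrite gt_eqF// expR_gt0.
Qed.

Lemma lmv_termE gam f p (y : N.-tuple R) : reproduces gam f -> MI N S p ->
  lmv_term s gam x0 p (rowt y) = L2_dot f (hermite_basis p) * hermite_basis p y.
Proof.
move=> rf pS; rewrite /lmv_term (acoef_L2_dot rf pS) mder_psi//.
by rewrite -mulrA.
Qed.

Definition representation gam (a : {ffun 'I_N -> nat} -> R) :=
  l2 (MI N S) a /\
  forall x, XS N S x -> ((gam x)%:E = ((nu s x0 x)^-1)%R%:E *
    ssum (MI N S)
      (fun p => (a p / Num.sqrt (mfact p)%:R * mpow (s^-1 *: x) p)%R))%E.

Lemma XS_scale k x : XS N S x -> XS N S (k *: x).
Proof. by apply: sub_XS => l; rewrite mxE => ->; rewrite mulr0. Qed.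

Lemma reproduces_representation gam f : reproduces gam f ->
  representation gam (fun p => L2_dot f (hermite_basis p)).
Proof.
move=> rf; split; first exact: (l2_dot dot_ge0 hermite_basis_orthonormal).
by move=> x xS; rewrite ssum_L2_dot_psi ?rf//; exact: XS_scale.
Qed.

Lemma representation_reproduces gam a : representation gam a ->
  exists f : L2, [/\ reproduces gam f,
    (forall p, MI N S p -> L2_dot f (hermite_basis p) = a p) &
    (\esum_(p in MI N S) (a p ^+ 2)%:E = (L2_dot f f)%:E)%E].
Proof.
move=> [l2a ra].
have [f fa nf] := riesz_fischer dot_ge0 hermite_basis_orthonormal
  (@L2_dot_complete _ _ _ _) l2a.
exists f; split => // x xS; apply: EFin_inj; rewrite ra// EFinM.
rewrite -ssum_L2_dot_psi; last exact: XS_scale.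
by congr (_ * _)%E; apply: eq_ssum => p pS; rewrite -fa.
Qed.

Lemma representation_acoef gam a p : representation gam a -> MI N S p ->
  a p = acoef s gam x0 p.
Proof.
move=> /representation_reproduces[f [rf fa _]] pS.
by rewrite -fa// (acoef_L2_dot rf pS).
Qed.

Lemma tupK : cancel (@rowt R N) (@tup R N).
Proof. by move=> y; apply: eq_from_tnth => i; rewrite tnth_mktuple mxE. Qed.

Lemma L2_rowt f : (f \o @tup R N) \o rowt = f.
Proof. by apply/funext => y /=; rewrite tupK. Qed.

Lemma validP g c : valid S s g c x0 <->
  exists f : L2, reproduces (fun x => c x + g x) f.
Proof.
split=> [[h /admissibleP[f _ rf]]|[f rf]]; first by exists f.
by exists (f \o @tup R N); apply/admissibleP; exists f; first exact: L2_rowt.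
Qed.

Section minimum_variance.
Variables g c : 'rV[R]_N -> R.
Hypothesis x0S : XS N S x0.
Local Notation gam := (fun x => c x + g x).
Local Notation coef_norm :=
  (\esum_(p in MI N S) (acoef s gam x0 p ^+ 2)%:E).

Lemma var_reproduces h f : h \o rowt = f -> reproduces gam f ->
  var s x0 h = ((L2_dot f f)%:E - (gam x0 ^+ 2)%:E)%E.
Proof.
move=> hf rf; rewrite -EFinB.
by apply: var_L2 => //; rewrite (Ex_psi hf) -rf.
Qed.

Lemma le_coef_norm f : reproduces gam f -> (coef_norm <= (L2_dot f f)%:E)%E.
Proof.
move=> rf.
apply: le_trans (bessel dot_ge0 hermite_basis_orthonormal f _).
by apply: le_esum => p pS; rewrite (acoef_L2_dot rf pS).
Qed.

Lemma minimum_norm_reproduces : valid S s g c x0 ->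
  exists2 f : L2, reproduces gam f & coef_norm = (L2_dot f f)%:E.
Proof.
move=> /validP[f0 rf0].
have [f [rf _ nf]] := representation_reproduces (reproduces_representation rf0).
exists f => //; rewrite -nf; apply: eq_esum => p pS.
by rewrite (acoef_L2_dot rf0 pS).
Qed.

Lemma Mmin_esum : valid S s g c x0 ->
  Mmin S s g c x0 = (coef_norm - (gam x0 ^+ 2)%:E)%E.
Proof.
move=> /minimum_norm_reproduces[f rf nf].
apply/eqP; rewrite eq_le; apply/andP; split.
  rewrite nf -(var_reproduces (L2_rowt f) rf); apply: ereal_inf_lbound.
  exists (f \o @tup R N) => //; apply/admissibleP.
  by exists f; first exact: L2_rowt.
apply: le_ereal_inf_tmp => _ [h /admissibleP[f' hf' rf'] <-].
by rewrite (var_reproduces hf' rf') leeB// le_coef_norm.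
Qed.

Lemma LMVP h : LMV S s g c x0 h <->
  exists f : L2,
    [/\ h \o rowt = f, reproduces gam f & coef_norm = (L2_dot f f)%:E].
Proof.
split=> [[ah vh]|[f [hf rf nf]]]; last first.
  have ah : admissible S s g c x0 h by apply/admissibleP; exists f.
  by split=> //; rewrite Mmin_esum ?nf ?(var_reproduces hf rf)//; exists h.
have /admissibleP[f hf rf] := ah; exists f; split=> //.
have vl : valid S s g c x0 by exists h.
move: vh; rewrite (var_reproduces hf rf) (Mmin_esum vl).
have [f' _ ->] := minimum_norm_reproduces vl.
by rewrite -!EFinB => -[/addIr ->].
Qed.

Lemma LMV_exists : valid S s g c x0 -> exists h, LMV S s g c x0 h.
Proof.
move=> /minimum_norm_reproduces[f rf nf]; exists (f \o @tup R N).
by apply/LMVP; exists f; split=> //; exact: L2_rowt.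
Qed.

Lemma LMV_expansion h (e : R) : LMV S s g c x0 h -> 0 < e ->
  \forall F \near finite_subsets (MI N S),
    (Ex s x0 (fun y =>
       ((h y - \sum_(p \in F) lmv_term s gam x0 p y) ^+ 2)%R) < e%:E)%E.
Proof.
move=> /LMVP[f [hf rf nf]] e0.
have full : \esum_(p in MI N S) (L2_dot f (hermite_basis p) ^+ 2)%:E =
    (L2_dot f f)%:E.
  by rewrite -nf; apply: eq_esum => p pS; rewrite (acoef_L2_dot rf pS).
have cvgf := cvg_fourier hermite_basis_orthonormal full.
apply: filterS2 (near_fsets _) (cvgr_lt _ cvgf _ e0) => F [finF FS] lte.
rewrite (Ex_sqr (f := f - lin_comb hermite_basis
  (fun p => L2_dot f (hermite_basis p)) F)) ?lte_fin//.
apply/funext => y /=.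
rewrite -[RHS]/(f y - _) -hf /lin_comb !fsbig_finite//= L2_sumE; congr (_ - _).
apply: eq_big_seq => p; rewrite in_fset_set// inE => /FS pS.
exact: lmv_termE rf pS.
Qed.

End minimum_variance.
End lmv.

Theorem theorem10 (R : realType) (N S : nat) (s : R)
  (g : 'rV[R]_N -> R) (x0 : 'rV[R]_N) :
  (1 <= S <= N)%N -> 0 < s -> XS N S x0 ->
  forall c : 'rV[R]_N -> R,
  let gam := fun x => c x + g x in
  let rep := fun a : {ffun 'I_N -> nat} -> R =>
    l2 (MI N S) a /\
    forall x, XS N S x ->
      ((gam x)%:E =
       ((nu s x0 x)^-1)%R%:E *
       ssum (MI N S) (fun p => (a p / Num.sqrt (mfact p)%:R * mpow (s^-1 *: x) p)%R))%E in
  (* (1) validity <-> representation, with a unique coefficient sequence *)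
  (valid S s g c x0 <-> exists a, rep a) /\
  (forall a b, rep a -> rep b -> forall p, MI N S p -> a p = b p) /\
  (* (2) minimum variance and LMV estimator *)
  (valid S s g c x0 ->
     (Mmin S s g c x0 =
        (\esum_(p in MI N S) ((acoef s gam x0 p) ^+ 2)%:E - ((gam x0) ^+ 2)%:E)%E) /\
     (exists h, LMV S s g c x0 h) /\
     (forall h, LMV S s g c x0 h ->
        forall e : R, 0 < e ->
        exists F0 : set {ffun 'I_N -> nat},
          [/\ finite_set F0, F0 `<=` MI N S &
          forall F : set {ffun 'I_N -> nat},
            finite_set F -> F0 `<=` F -> F `<=` MI N S ->
            (Ex s x0 (fun y => ((h y - \sum_(p \in F) lmv_term s gam x0 p y) ^+ 2)%R)
               < e%:E)%E])).
Proof.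
move=> _ s0 x0S c gam rep; have s_neq0 : s != 0 by rewrite gt_eqF.
split; [|split] => [|a b repa repb p pS|vc].
- split=> [/(validP S x0 s_neq0)[f rf]|[a]].
    by exists (fun p => L2_dot f (hermite_basis x0 s_neq0 p));
      exact: reproduces_representation.
  move=> /(representation_reproduces s_neq0)[f [rf _ _]].
  by apply/(validP S x0 s_neq0); exists f.
- rewrite (representation_acoef s_neq0 repa pS).
  by rewrite (representation_acoef s_neq0 repb pS).
split; [exact: (Mmin_esum s_neq0)|split; first exact: (LMV_exists s_neq0)].
move=> h lmvh e e0.
have [F0 [finF0 F0S] near_lt] := LMV_expansion s_neq0 x0S lmvh e0.
by exists F0; split=> // F finF F0F FS; exact: near_lt.
Qed.
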